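(* Let $(M^3,\mathcal T)$ be a triangulated 3-manifold with vertices $1,\dots,N$, and let $\alpha,\beta\in\mathbb R$. Suppose $r^*\in\mathfrak M_{\mathcal T}$ is a constant $\alpha$-curvature metric satisfying $\lambda_1(-\Delta_\alpha)>\alpha s_\alpha^*$ at $r^*$, where $s_\alpha^*=s_\alpha(r^* )$; or, more specifically, suppose $r^*\in\mathfrak M_{\mathcal T}$ is a constant $\alpha$-curvature metric with $\alpha s_\alpha^*\le 0$. If $\|r(0)-r^*\|$ is small enough, then the solution $r(t)$ of the unified $(\alpha,\beta)$-flow $$\frac{dr_i}{dt}=s_\alpha r_i^{\beta}-K_i r_i^{\beta-\alpha},\qquad i=1,\dots,N,\qquad s_\alpha=\frac{\sum_{i=1}^N K_i r_i}{\sum_{i=1}^N r_i^{\alpha+1}},$$ with initial value $r(0)$ exists for all time and converges to $r^*$.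
   Context: A triangulated 3-manifold $(M^3,\mathcal T)$ is a closed 3-manifold with a triangulation $\mathcal T=\{\mathcal T_0,\mathcal T_1,\mathcal T_2,\mathcal T_3\}$, $\mathcal T_i$ being the set of $i$-simplices; $N$ is the number of vertices; $i\sim j$ means $\{ij\}\in\mathcal T_1$. Ball packing metrics (Cooper–Rivin). For $r\in\mathbb R^N_{>0}=(0,+\infty)^N$ each edge $\{ij\}$ gets length $l_{ij}=r_i+r_j$. The map $r$ is a (non-degenerate) ball packing metric if for each $\{i,j,k,l\}\in\mathcal T_3$ the six lengths determine a Euclidean tetrahedron, equivalently $$Q_{ijkl}=\Big(\tfrac1{r_i}+\tfrac1{r_j}+\tfrac1{r_k}+\tfrac1{r_l}\Big)^2-2\Big(\tfrac1{r_i^2}+\tfrac1{r_j^2}+\tfrac1{r_k^2}+\tfrac1{r_l^2}\Big)>0.$$ $\mathfrak M_{\mathcal T}=\{r\in\mathbb R^N_{>0}: Q_{ijkl}>0\ \text{for all}\ \{i,j,k,l\}\in\mathcal T_3\}$ is the space of all ball packing metrics, an open subset of $\mathbb R^N_{>0}$. With $\alpha_{ijkl}$ the solid angle at vertex $i$ of the Euclidean tetrahedron $\{i,j,k,l\}$, the discrete scalar curvature is $K_i=4\pi-\sum_{\{i,j,k,l\}\in\mathcal T_3}\alpha_{ijkl}$, summed over all tetrahedra having $i$ as a vertex; it is a smooth function of $r\in\mathfrak M_{\mathcal T}$. A constant $\alpha$-curvature metric is $r\in\mathfrak M_{\mathcal T}$ for which $K_i/r_i^{\alpha}$ has the same value for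 all vertices $i$ (this value is then necessarily $s_\alpha$). The $\alpha$-Laplacian at $r$ acts on functions $f:\mathcal T_0\to\mathbb R$ (column vectors in $\mathbb R^N$) by $$\Delta_\alpha f_i=\frac1{r_i^\alpha}\sum_{j\sim i}\Big(-\frac{\partial K_i}{\partial r_j}r_j\Big)(f_j-f_i);$$ in matrix form $\Delta_\alpha=-\Sigma^{-\alpha}\Lambda\Sigma$, where $\Sigma=\mathrm{diag}\{r_1,\dots,r_N\}$ and $\Lambda=\big(\partial K_i/\partial r_j\big)_{1\le i,j\le N}$. Known fact (Cooper–Rivin, Glickenstein, Rivin): $\Lambda$, the Hessian in $r$ of $\sum_i K_ir_i$, is positive semi-definite of rank $N-1$, with kernel spanned by the vector $r$. Hence $-\Delta_\alpha$ has real eigenvalues, $0$ being a simple one and all others positive; $\lambda_1(-\Delta_\alpha)$ denotes the first (smallest) positive eigenvalue.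
   Formalization: As r(0)=c r* is stationary, convergence to r* is claimed only if r(0) and r* have equal conserved quantity Σ r_i^(α−β+2) (Σ ln r_i if α−β+2=0); in general the solution exists for all time, is unique, and converges to the multiple c r*, c>0, with the conserved quantity of r(0). *)

(* Defs.v *)
From HB Require Import structures.
From mathcomp Require Export all_boot all_order all_algebra.
From mathcomp Require Export all_classical all_reals all_analysis.
Set Implicit Arguments.
Unset Strict Implicit.
Unset Printing Implicit Defensive.
Import Order.TTheory GRing.Theory Num.Theory.
Import numFieldNormedType.Exports.
Local Open Scope classical_set_scope.
Local Open Scope ring_scope.

(** ** Triangulated 3-manifolds *)

Definition homeomorphic (X Y : topologicalType) (A : set X) (B : set Y) :=
  exists (f : X -> Y) (g : Y -> X),
    [/\ {within A, continuous f}, {within B, continuous g},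
        forall x, A x -> B (f x) /\ g (f x) = x &
        forall y, B y -> A (g y) /\ f (g y) = y].

(* "Closed manifold" means compact, without boundary and, as is implicit in
   the fact that the kernel of the Jacobian of the curvature is a line,
   connected. *)
Record closed_3manifold (R : realType) (M : topologicalType) : Prop := {
  c3m_hausdorff : hausdorff_space M;
  c3m_second_countable : @second_countable M;
  c3m_compact : compact [set: M];
  c3m_connected : connected [set: M];
  c3m_charts : forall x : M, exists U : set M,
    [/\ open U, U x & homeomorphic U [set: 'rV[R]_3]]
}.

(* T is the set of all nonempty simplices, each given by its vertex set.  That
   every simplex is a face of a tetrahedron is automatic for a triangulation
   of a 3-manifold (invariance of domain). *)
Record simplicial_3complex (N : nat) (T : {set {set 'I_N}}) : Prop := {
  s3c_nonempty : forall s, s \in T -> (0 < #|s|)%N;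
  s3c_faces : forall s t : {set 'I_N},
    s \in T -> t \subset s -> (0 < #|t|)%N -> t \in T;
  s3c_vertices : forall i : 'I_N, [set i]%SET \in T;
  s3c_pure : forall s, s \in T ->
    exists t : {set 'I_N}, [/\ t \in T, #|t| = 4%N & s \subset t]
}.

(* Geometric realization, in barycentric coordinates. *)
Definition realization (R : realType) (N : nat) (T : {set {set 'I_N}}) :
    set 'rV[R]_N :=
  [set x | [/\ forall i, 0 <= x 0 i, \sum_i x 0 i = 1 &
               [set i | x 0 i != 0]%SET \in T]].

Definition triangulated_3manifold (R : realType) (M : topologicalType)
    (N : nat) (T : {set {set 'I_N}}) : Prop :=
  [/\ closed_3manifold R M, simplicial_3complex T &
      homeomorphic (@realization R N T) [set: M]].

Section BallPacking.
Variables (R : realType) (N : nat) (T : {set {set 'I_N}}).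
Implicit Types (r : 'rV[R]_N) (s : {set 'I_N}) (i j k l : 'I_N).

Definition tetrahedra : {set {set 'I_N}} := [set s in T | #|s| == 4]%SET.

(** ** Ball packing metrics *)

Definition Q r s : R :=
  (\sum_(i in s) (r 0 i)^-1) ^+ 2 - 2 * \sum_(i in s) ((r 0 i) ^+ 2)^-1.

Definition ball_packing_metrics : set 'rV[R]_N :=
  [set r : 'rV[R]_N | (forall i, 0 < r 0 i) /\ (forall s, s \in tetrahedra -> 0 < Q r s)].

Definition edge_length r i j : R := r 0 i + r 0 j.

(** ** Solid angles and curvature *)

(* Inner product of the edge vectors ij and ik: by polarization it is
   determined by the lengths of the three sides of the triangle ijk.  The case
   j = k is separate because edge_length r j j is not 0. *)
Definition edge_dot r i j k : R :=
  if j == k then edge_length r i j ^+ 2 else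
  (edge_length r i j ^+ 2 + edge_length r i k ^+ 2 - edge_length r j k ^+ 2)
    / 2.

(* Inner product of the components of ik and il orthogonal to ij. *)
Definition edge_dot_perp r i j k l : R :=
  edge_dot r i k l
    - edge_dot r i j k * edge_dot r i j l / edge_dot r i j j.

(* Dihedral angle of the tetrahedron ijkl along the edge ij. *)
Definition dihedral r i j k l : R :=
  acos (edge_dot_perp r i j k l /
        (Num.sqrt (edge_dot_perp r i j k k)
         * Num.sqrt (edge_dot_perp r i j l l))).

(* Solid angle at i: the area of the spherical triangle cut out on the unit
   sphere at i, i.e. the excess over pi of its angles, which are the dihedral
   angles along ij, ik and il. *)
Definition solid_angle r i j k l : R :=
  dihedral r i j k l + dihedral r i k l j + dihedral r i l j k - pi.

(* solid_angle is symmetric in its last three arguments, so the order in which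
   enum lists them is irrelevant. *)
Definition solid_angle_at r s i : R :=
  if enum (s :\ i)%SET is [:: j; k; l] then solid_angle r i j k l else 0.

Definition K r i : R :=
  4 * pi - \sum_(s in tetrahedra | i \in s) solid_angle_at r s i.

Definition s_alpha (alpha : R) r : R :=
  (\sum_i K r i * r 0 i) / (\sum_i r 0 i `^ (alpha + 1)).

Definition constant_curvature_metric (alpha : R) r : Prop :=
  ball_packing_metrics r /\
  forall i j, K r i / r 0 i `^ alpha = K r j / r 0 j `^ alpha.

(** ** The alpha-Laplacian *)

Definition Lambda r : 'M[R]_N :=
  \matrix_(i, j) 'D_(delta_mx 0 j : 'rV[R]_N) (fun r' => K r' i) r.

Definition Laplacian (alpha : R) r : 'M[R]_N :=
  - (diag_mx (\row_i r 0 i `^ (- alpha)) *m Lambda r *m diag_mx r).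

(* eigenvalue is stated with row vectors, but a square matrix and its transpose
   have the same eigenvalues. *)
Definition is_first_positive_eigenvalue (A : 'M[R]_N) (lambda1 : R) : Prop :=
  [/\ 0 < lambda1, eigenvalue A lambda1 &
      forall mu, 0 < mu -> eigenvalue A mu -> lambda1 <= mu].

(** ** The (alpha, beta)-flow *)

Definition flow_field (alpha beta : R) r i : R :=
  s_alpha alpha r * r 0 i `^ beta - K r i * r 0 i `^ (beta - alpha).

(* r solves the flow on [0, b[ (b may be +oo), with r(0) = r0. *)
Definition flow_solution (alpha beta : R) (r0 : 'rV[R]_N) (b : \bar R)
    (r : R -> 'rV[R]_N) : Prop :=
  [/\ r 0 = r0,
      forall t, 0 <= t -> (t%:E < b)%E -> ball_packing_metrics (r t),
      {within [set t | 0 <= t /\ (t%:E < b)%E], continuous r} &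
      forall t, 0 < t -> (t%:E < b)%E -> forall i,
        is_derive t 1 (fun u => r u 0 i) (flow_field alpha beta (r t) i)].

(* The quantity preserved by the flow: along a solution,
   \sum_i r_i^(alpha - beta + 1) dr_i/dt
     = s_alpha * \sum_i r_i^(alpha + 1) - \sum_i K_i r_i = 0.
   K, hence the set of constant curvature metrics, is invariant under scaling,
   and this quantity determines a metric on the ray through a given one. *)
Definition flow_invariant (alpha beta : R) r : R :=
  if alpha - beta + 2 == 0 then \sum_i ln (r 0 i)
  else \sum_i r 0 i `^ (alpha - beta + 2).

End BallPacking.

(* Main.v *)
(* Write x_i = 1/r_i.  In a tetrahedron ijkl the dihedral angle along ij is an
   arccosine of an explicit function of the x's, and differentiating it gives
   r_i r_j d(alpha_i)/d(r_j) = w_ij with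

     w_ij = x_i x_j x_k x_l (q + t_k t_l) / (s_k s_l sqrt q),

   where q = Q/4, t_i = (x_j + x_k + x_l - x_i)/2 and s_i = x_i (t_i^2 + q).
   As w is symmetric and the angles are homogeneous of degree 0, the tetrahedron
   contributes sum_(i<j) w_ij (f_i - f_j)^2 to <z, Lambda z>, f_i = z_i / r_i.
   The part with q is positive unless f is constant, and the part with t_k t_l is
   nonnegative, even though one of the t_i (at most one) may be negative.
   Connectedness of M makes the kernel of Lambda the line spanned by r.

   With the weights m_i = r_i^(alpha - beta) at rstar, the linearized flow is
   minus a symmetric form B whose kernel is the line of rstar; by a Rayleigh
   quotient argument the spectral hypothesis makes B positive off that line,
   which is transverse to the level sets of the flow invariant.  All functions
   involved are strictly differentiable at rstar, so the estimate
   <m (r - e), F(r)> <= - kappa |r - e|^2 holds for r near rstar on the level set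
   of every nearby equilibrium e = c rstar.  Hence solutions that start near
   rstar exist forever and converge exponentially to e. *)
Require Import Defs.
From mathcomp Require Import ring lra.
Set Implicit Arguments.
Unset Strict Implicit.
Unset Printing Implicit Defensive.
Import Order.TTheory GRing.Theory Num.Theory.
Import numFieldNormedType.Exports.
Local Open Scope classical_set_scope.
Local Open Scope ring_scope.

(** * Four mutually tangent balls *)

Section Tetrahedron.
Variable R : realFieldType.
Implicit Types a b c d : R.

(** Inverse radii are the right variables: up to common factors that cancel, Q, the triangle areas
    and the Gram entries of the dihedral angles are polynomial in them, so every derivative reduces
    to a rational identity. The obstacle in the dynamics is that each multiple of [rstar] is an
    equilibrium and the limit depends on the initial value. An expansion centred at [rstar] leaves
    an error in |r - rstar|, whereas the dissipation estimate needs one in |r - e|. Strict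
    differentiability is a two-point expansion, f(y) - f(z) = <g, y - z> + o(|y - z|) for all y, z
    near a single point, and gives exactly that. It asks for the gradient at [rstar] only, obeys the
    chain rule, and also yields the Lipschitz constant for Picard iteration. Coercivity is wanted on
    the whole space rather than on tangent spaces that vary with e. To this end the square of the
    differential of the flow invariant is added to B; between two points of one level set this
    square is o(|r - e|^2) and can be absorbed. *)

Definition descartes a b c d : R :=
  (a + b + c + d) ^+ 2 - 2 * (a ^+ 2 + b ^+ 2 + c ^+ 2 + d ^+ 2).
(** At inverse radii this is the inverse square of the inradius of the triangle of centres, or its
    squared area (Heron) divided by the squared product of the radii. *)
Definition sym2 a b c : R := a * b + b * c + c * a.
(** Numerator of the cosine of the dihedral angle along ij; the denominator is the product of the
    square roots of [2 * sym2 a b c] and [2 * sym2 a b d]. *)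
Definition cosnum a b c d : R := (a + b) * (c + d) - a ^+ 2 - b ^+ 2.

(** The left side is, up to a positive factor, the Gram determinant of the components of ik and il
    orthogonal to ij. Hence Q > 0 puts the cosine of the dihedral angle strictly between -1 and
    1. *)
Lemma descartes_gram a b c d :
  (2 * sym2 a b c) * (2 * sym2 a b d) - cosnum a b c d ^+ 2 =
  descartes a b c d * (a + b) ^+ 2.
Proof. rewrite /descartes /sym2 /cosnum; ring. Qed.

(* [dangle_near a b c d] and [dangle_far a b c d] are sqrt Q times the derivatives
   with respect to a and to c of the dihedral angle along ij, where a, b, c, d are
   the inverse radii of i, j, k, l. *)
Definition dangle_near a b c d : R :=
  - (c + d - 2 * a - cosnum a b c d *
     ((b + c) / (2 * sym2 a b c) + (b + d) / (2 * sym2 a b d))) / (a + b).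
Definition dangle_far a b c d : R :=
  - ((a + b) * (a + b + c - d)) / (2 * sym2 a b c).

(* sqrt Q times w_ij. *)
Definition weight a b c d : R :=
  2 * a * b *
  (descartes a b c d / 4 + ((a + b + d - c) / 2) * ((a + b + c - d) / 2))
  / (sym2 a b c * sym2 a b d).

(* sqrt Q times the derivatives of the solid angle at i with respect to a and b. *)
Definition dsolid_self a b c d : R :=
  dangle_near a b c d + dangle_near a c d b + dangle_near a d b c.
Definition dsolid_other a b c d : R :=
  dangle_near b a c d + dangle_far a c b d + dangle_far a d b c.

(** Since b = 1/r_j has derivative - b^2, this amounts to r_i r_j d(alpha_i)/d(r_j) = [weight] /
    sqrt Q. *)
Lemma dsolid_otherE a b c d : 0 < a -> 0 < b -> 0 < c -> 0 < d ->
  dsolid_other a b c d * b = - weight a b c d * a.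
Proof.
move=> a0 b0 c0 d0; rewrite /dsolid_other /weight /dangle_near /dangle_far /cosnum
  /descartes /sym2.
field.
by rewrite !lt0r_neq0 ?addr_gt0 ?mulr_gt0.
Qed.

(** Euler's relation for an angle of degree 0: with [dsolid_otherE], the sum of all derivatives
    times their variables vanishes. The common factor [a] is kept so as to rewrite products
    [dsolid_self a b c d * (a * h)]. *)
Lemma dsolid_selfE a b c d : 0 < a -> 0 < b -> 0 < c -> 0 < d ->
  dsolid_self a b c d * a =
   (weight a b c d + weight a c b d + weight a d b c) * a.
Proof.
move=> a0 b0 c0 d0; rewrite /dsolid_self /weight /dangle_near /cosnum /descartes /sym2.
field.
by rewrite !lt0r_neq0 ?addr_gt0 ?mulr_gt0.
Qed.

(** * Dirichlet forms on the edges of a tetrahedron *)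

Definition edge_form (w12 w13 w14 w23 w24 w34 : R) (f1 f2 f3 f4 : R) :=
  w12 * (f1 - f2) ^+ 2 + w13 * (f1 - f3) ^+ 2 + w14 * (f1 - f4) ^+ 2 +
  w23 * (f2 - f3) ^+ 2 + w24 * (f2 - f4) ^+ 2 + w34 * (f3 - f4) ^+ 2.

(** Each edge is weighted by the product of [g] over the two opposite vertices. Both parts of
    [weight] have this shape: with v_i as in [weight_coform], 1 / ([sym2 a b c] * [sym2 a b d]) is c
    d v3 v4, and the numerator is q + t_3 t_4. *)
Definition coform (g1 g2 g3 g4 f1 f2 f3 f4 : R) : R :=
  edge_form (g3 * g4) (g2 * g4) (g2 * g3) (g1 * g4) (g1 * g3) (g1 * g2) f1 f2 f3 f4.

(** Put G = g2 g3 g4, p_j = G / g_j and u_j = f_j - f1. The edge 1j has weight p_j and the edge ij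
    opposite to it has weight g1 p_i p_j / G, so Lagrange's identity turns G times the form into (G
    + g1 (p_2 + p_3 + p_4)) times the sum of the p_j u_j^2, minus g1 times the square of the sum of
    the p_j u_j. *)
Lemma coform_ge0 (g1 g2 g3 g4 f1 f2 f3 f4 : R) :
  g1 <= 0 -> 0 < g2 -> 0 < g3 -> 0 < g4 ->
  0 <= g2 * g3 * g4 + g1 * (g3 * g4 + g2 * g4 + g2 * g3) ->
  0 <= coform g1 g2 g3 g4 f1 f2 f3 f4.
Proof.
move=> g1_le0 g2_gt0 g3_gt0 g4_gt0 e3_ge0.
have G_gt0 : 0 < g2 * g3 * g4 by rewrite !mulr_gt0.
rewrite -(pmulr_rge0 _ G_gt0).
have -> : g2 * g3 * g4 * coform g1 g2 g3 g4 f1 f2 f3 f4 =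
  (g2 * g3 * g4 + g1 * (g3 * g4 + g2 * g4 + g2 * g3)) *
    (g3 * g4 * (f2 - f1) ^+ 2 + g2 * g4 * (f3 - f1) ^+ 2
     + g2 * g3 * (f4 - f1) ^+ 2) +
  (- g1) * (g3 * g4 * (f2 - f1) + g2 * g4 * (f3 - f1)
            + g2 * g3 * (f4 - f1)) ^+ 2.
  by rewrite /coform /edge_form; ring.
rewrite addr_ge0// mulr_ge0 ?oppr_ge0 ?sqr_ge0//.
by rewrite !addr_ge0// mulr_ge0 ?sqr_ge0// mulr_ge0// ltW.
Qed.

(* Here [v_i = 1 / s_i], because [x_i * sym2 x_j x_k x_l = x_i (t_i^2 + q)].  With
   [t_1 = - y], one has [q = bc + cd + db - y^2]. *)
Lemma coform_curvature_ge0 a b c d v1 v2 v3 v4 f1 f2 f3 f4 :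
  0 < a -> 0 < b -> 0 < c -> 0 < d -> 0 < descartes a b c d ->
  0 < v1 -> 0 < v2 -> 0 < v3 -> 0 < v4 ->
  v1 * (a * sym2 b c d) = 1 -> v2 * (b * sym2 a c d) = 1 ->
  v3 * (c * sym2 a b d) = 1 -> v4 * (d * sym2 a b c) = 1 ->
  b + c + d - a <= 0 ->
  0 <= coform ((b + c + d - a) / 2 * v1) ((a + c + d - b) / 2 * v2)
         ((a + b + d - c) / 2 * v3) ((a + b + c - d) / 2 * v4) f1 f2 f3 f4.
Proof.
move=> a0 b0 c0 d0 Q0 v10 v20 v30 v40 e1 e2 e3 e4 t1_le0.
pose y := (a - (b + c + d)) / 2.
have y_ge0 : 0 <= y by rewrite /y; lra.
have aE : a = b + c + d + 2 * y by rewrite /y; field.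
have t1E : (b + c + d - a) / 2 = - y by rewrite /y; field.
have t2E : (a + c + d - b) / 2 = c + d + y by rewrite /y; field.
have t3E : (a + b + d - c) / 2 = b + d + y by rewrite /y; field.
have t4E : (a + b + c - d) / 2 = b + c + y by rewrite /y; field.
rewrite t1E t2E t3E t4E.
have q0 : 0 < sym2 b c d - y ^+ 2.
  move: Q0; rewrite /descartes /sym2 aE.
  set e := (X in 0 < X -> _); have -> : e = 4 * (b * c + c * d + d * b - y ^+ 2).
    by rewrite /e; ring.
  by rewrite pmulr_rgt0.
have cd0 : 0 < c + d + y by lra.
have bd0 : 0 < b + d + y by lra.
have bc0 : 0 < b + c + y by lra.
apply: coform_ge0; rewrite ?mulr_gt0//; first by rewrite mulr_le0_ge0 ?oppr_le0// ltW.
set e := (X in 0 <= X).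
(* The third elementary symmetric polynomial of the t_i v_i. Once each v_i is cleared by its
   equation v_i s_i = 1, it factors through q, and the cofactor has positive terms only. *)
have -> : e = v1 * v2 * v3 * v4 * ((sym2 b c d - y ^+ 2) *
    (b * (c + d) * (b + d + y) * (b + c + y)
     + c * (b + d) * (c + d + y) * (b + c + y)
     + d * (b + c) * (c + d + y) * (b + d + y))).
  rewrite /e.
  transitivity ((v1 * (a * sym2 b c d)) * ((c + d + y) * v2 * ((b + d +
    y) * v3) * ((b + c + y) * v4)) +
   - y * v1 * ((b + d + y) * v3 * ((b + c + y) * v4) * (v2 * (b * sym2 a c d))
     + (c + d + y) * v2 * ((b + c + y) * v4) * (v3 * (c * sym2 a b d)) + (c + d +
       y) * v2 * ((b + d + y) * v3) * (v4 * (d * sym2 a b c)))).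
    by rewrite e1 e2 e3 e4 !mulr1 mul1r.
  by rewrite /sym2 aE; ring.
move: (_ - _) q0 => q q0; apply/ltW.
by do ?[assumption|apply: mulr_gt0|apply: addr_gt0].
Qed.

Definition weight_form a b c d f1 f2 f3 f4 : R :=
  edge_form (weight a b c d) (weight a c b d) (weight a d b c)
            (weight b c a d) (weight b d a c) (weight c d a b) f1 f2 f3 f4.

Lemma weight_coform a b c d v1 v2 v3 v4 f1 f2 f3 f4 :
  0 < a -> 0 < b -> 0 < c -> 0 < d ->
  v1 = (a * sym2 b c d)^-1 -> v2 = (b * sym2 a c d)^-1 ->
  v3 = (c * sym2 a b d)^-1 -> v4 = (d * sym2 a b c)^-1 ->
  weight_form a b c d f1 f2 f3 f4 =
  2 * (a * b * c * d) *
  (descartes a b c d / 4 * coform v1 v2 v3 v4 f1 f2 f3 f4 +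
   coform ((b + c + d - a) / 2 * v1) ((a + c + d - b) / 2 * v2)
         ((a + b + d - c) / 2 * v3) ((a + b + c - d) / 2 * v4) f1 f2 f3 f4).
Proof.
move=> a0 b0 c0 d0 -> -> -> ->; rewrite /weight_form /coform /edge_form /weight.
have s1 : sym2 b c d != 0 by rewrite lt0r_neq0// !addr_gt0// mulr_gt0.
have s2 : sym2 a c d != 0 by rewrite lt0r_neq0// !addr_gt0// mulr_gt0.
have s3 : sym2 a b d != 0 by rewrite lt0r_neq0// !addr_gt0// mulr_gt0.
have s4 : sym2 a b c != 0 by rewrite lt0r_neq0// !addr_gt0// mulr_gt0.
have -> : sym2 a c b = sym2 a b c by rewrite /sym2; ring.
have -> : sym2 a d b = sym2 a b d by rewrite /sym2; ring.
have -> : sym2 a d c = sym2 a c d by rewrite /sym2; ring.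
have -> : sym2 b c a = sym2 a b c by rewrite /sym2; ring.
have -> : sym2 b d a = sym2 a b d by rewrite /sym2; ring.
have -> : sym2 b d c = sym2 b c d by rewrite /sym2; ring.
have -> : sym2 c d a = sym2 a c d by rewrite /sym2; ring.
have -> : sym2 c d b = sym2 b c d by rewrite /sym2; ring.
have -> : descartes a c b d = descartes a b c d by rewrite /descartes; ring.
have -> : descartes a d b c = descartes a b c d by rewrite /descartes; ring.
have -> : descartes b c a d = descartes a b c d by rewrite /descartes; ring.
have -> : descartes b d a c = descartes a b c d by rewrite /descartes; ring.
have -> : descartes c d a b = descartes a b c d by rewrite /descartes; ring.
move: (descartes _ _ _ _) => q.
move: s1 s2 s3 s4; move: (sym2 a b c) (sym2 b c d) (sym2 a b d) (sym2 a c d) =>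
  u1 u2 u3 u4 n1 n2 n3 n4.
field.
by rewrite n1 n2 n3 n4 !lt0r_neq0.
Qed.

Lemma coform_gt0 (g1 g2 g3 g4 f1 f2 f3 f4 : R) :
  0 < g1 -> 0 < g2 -> 0 < g3 -> 0 < g4 ->
  ~ [/\ f1 = f2, f1 = f3 & f1 = f4] ->
  0 < coform g1 g2 g3 g4 f1 f2 f3 f4.
Proof.
move=> g10 g20 g30 g40 nconst; rewrite lt0r.
have hge0 (g g' f f' : R) : 0 < g -> 0 < g' -> 0 <= g * g' * (f - f') ^+ 2.
  by move=> ? ?; rewrite mulr_ge0 ?sqr_ge0// ltW// mulr_gt0.
rewrite /coform /edge_form !addr_ge0 ?hge0// andbT.
apply/negP; rewrite !paddr_eq0 ?addr_ge0 ?hge0//.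
have heq (g g' f f' : R) : 0 < g -> 0 < g' -> g * g' * (f - f') ^+ 2 == 0 -> f = f'.
  move=> g0 g'0; rewrite mulf_eq0 sqrf_eq0 subr_eq0 gt_eqF ?mulr_gt0//=.
  by move/eqP.
move=> /andP[/andP[/andP[/andP[/andP[/heq h1 /heq h2] /heq h3] _] _] _].
by apply: nconst; split; [exact: h1|exact: h2|exact: h3].
Qed.

(* At most one of the numbers [x_j + x_k + x_l - x_i] is negative, since any two
   of them have a positive sum. *)
Lemma weight_form_gt0 a b c d f1 f2 f3 f4 :
  0 < a -> 0 < b -> 0 < c -> 0 < d -> 0 < descartes a b c d ->
  ~ [/\ f1 = f2, f1 = f3 & f1 = f4] ->
  0 < weight_form a b c d f1 f2 f3 f4.
Proof.
move=> a0 b0 c0 d0 Q0 nconst.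
have s1 : 0 < a * sym2 b c d by rewrite mulr_gt0// !addr_gt0// mulr_gt0.
have s2 : 0 < b * sym2 a c d by rewrite mulr_gt0// !addr_gt0// mulr_gt0.
have s3 : 0 < c * sym2 a b d by rewrite mulr_gt0// !addr_gt0// mulr_gt0.
have s4 : 0 < d * sym2 a b c by rewrite mulr_gt0// !addr_gt0// mulr_gt0.
rewrite (weight_coform _ _ _ _ a0 b0 c0 d0 erefl erefl erefl erefl).
have v1 : 0 < (a * sym2 b c d)^-1 by rewrite invr_gt0.
have v2 : 0 < (b * sym2 a c d)^-1 by rewrite invr_gt0.
have v3 : 0 < (c * sym2 a b d)^-1 by rewrite invr_gt0.
have v4 : 0 < (d * sym2 a b c)^-1 by rewrite invr_gt0.
have i1 : (a * sym2 b c d)^-1 * (a * sym2 b c d) = 1 by rewrite mulVf ?gt_eqF.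
have i2 : (b * sym2 a c d)^-1 * (b * sym2 a c d) = 1 by rewrite mulVf ?gt_eqF.
have i3 : (c * sym2 a b d)^-1 * (c * sym2 a b d) = 1 by rewrite mulVf ?gt_eqF.
have i4 : (d * sym2 a b c)^-1 * (d * sym2 a b c) = 1 by rewrite mulVf ?gt_eqF.
move: (_^-1) (_^-1) (_^-1) (_^-1) v1 v2 v3 v4 i1 i2 i3 i4 =>
  v4 v3 v2 v1 v10 v20 v30 v40 i1 i2 i3 i4.
rewrite pmulr_rgt0; last by rewrite !mulr_gt0.
apply: ltr_wpDr; last by rewrite mulr_gt0 ?divr_gt0// coform_gt0.
case: (leP (b + c + d - a) 0) => [t1|t1].
  exact: coform_curvature_ge0.
case: (leP (a + c + d - b) 0) => [t2|t2].
  suff : 0 <= coform ((a + c + d - b) / 2 * v2) ((b + c + d - a) / 2 * v1) ((b +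
    a + d - c) / 2 * v3) ((b + a + c - d) / 2 * v4) f2 f1 f3 f4.
    by congr (_ <= _); rewrite /coform /edge_form; ring.
  apply: coform_curvature_ge0 => //.
  - by move: Q0; congr (_ < _); rewrite /descartes; ring.
  - by rewrite -i3 /sym2; ring.
  - by rewrite -i4 /sym2; ring.
case: (leP (a + b + d - c) 0) => [t3|t3].
  suff : 0 <= coform ((a + b + d - c) / 2 * v3) ((c + b + d - a) / 2 * v1) ((c +
    a + d - b) / 2 * v2) ((c + a + b - d) / 2 * v4) f3 f1 f2 f4.
    by congr (_ <= _); rewrite /coform /edge_form; ring.
  apply: coform_curvature_ge0 => //.
  - by move: Q0; congr (_ < _); rewrite /descartes; ring.
  - by rewrite -i1 /sym2; ring.
  - by rewrite -i2 /sym2; ring.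
  - by rewrite -i4 /sym2; ring.
case: (leP (a + b + c - d) 0) => [t4|t4].
  suff : 0 <= coform ((a + b + c - d) / 2 * v4) ((d + b + c - a) / 2 * v1) ((d +
    a + c - b) / 2 * v2) ((d + a + b - c) / 2 * v3) f4 f1 f2 f3.
    by congr (_ <= _); rewrite /coform /edge_form; ring.
  apply: coform_curvature_ge0 => //.
  - by move: Q0; congr (_ < _); rewrite /descartes; ring.
  - by rewrite -i1 /sym2; ring.
  - by rewrite -i2 /sym2; ring.
  - by rewrite -i3 /sym2; ring.
by rewrite ltW// coform_gt0// mulr_gt0// divr_gt0.
Qed.

Definition weight_bil a b c d f1 f2 f3 f4 h1 h2 h3 h4 : R :=
  weight a b c d * ((f1 - f2) * (h1 - h2)) + weight a c b d * ((f1 - f3) * (h1 - h3)) +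
  weight a d b c * ((f1 - f4) * (h1 - h4)) + weight b c a d * ((f2 - f3) * (h2 - h3)) +
  weight b d a c * ((f2 - f4) * (h2 - h4)) + weight c d a b * ((f3 - f4) * (h3 - h4)).

Lemma weight_bilxx a b c d f1 f2 f3 f4 :
  weight_bil a b c d f1 f2 f3 f4 f1 f2 f3 f4 = weight_form a b c d f1 f2 f3 f4.
Proof. by rewrite /weight_bil /weight_form /edge_form; ring. Qed.

Lemma weightC12 a b c d : weight a b c d = weight b a c d.
Proof.
rewrite /weight; congr (_ / _); first by rewrite /descartes; ring.
by rewrite /sym2; ring.
Qed.

Lemma dangle_nearC34 a b c d : dangle_near a b c d = dangle_near a b d c.
Proof. by rewrite /dangle_near /cosnum; ring. Qed.

(** Take z_i = r_i f_i and z'_i = r_i h_i. Moving the radii along z' moves the inverse radius a by -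
    a h1, so the left side is - sqrt Q times the sum of the z_i d(alpha_i)(z'). The right side is
    symmetric in f and h, whence the symmetry of the Jacobian. *)
Lemma solid_bilinear a b c d f1 f2 f3 f4 h1 h2 h3 h4 :
  0 < a -> 0 < b -> 0 < c -> 0 < d ->
  f1 / a * (dsolid_self a b c d * (a * h1) + dsolid_other a b c d * (b * h2) +
            dsolid_other a c b d * (c * h3) + dsolid_other a d b c * (d * h4)) +
  f2 / b * (dsolid_self b a c d * (b * h2) + dsolid_other b a c d * (a * h1) +
            dsolid_other b c a d * (c * h3) + dsolid_other b d a c * (d * h4)) +
  f3 / c * (dsolid_self c a b d * (c * h3) + dsolid_other c a b d * (a * h1) +
            dsolid_other c b a d * (b * h2) + dsolid_other c d a b * (d * h4)) +
  f4 / d * (dsolid_self d a b c * (d * h4) + dsolid_other d a b c * (a * h1) +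
            dsolid_other d b a c * (b * h2) + dsolid_other d c a b * (c * h3)) =
  weight_bil a b c d f1 f2 f3 f4 h1 h2 h3 h4.
Proof.
move=> a0 b0 c0 d0.
have hS (x y z t h : R) : 0 < x -> 0 < y -> 0 < z -> 0 < t ->
    dsolid_self x y z t * (x * h) = (weight x y z t + weight x z y t +
      weight x t y z) * x * h.
  by move=> *; rewrite mulrA dsolid_selfE.
have hO (x y z t h : R) : 0 < x -> 0 < y -> 0 < z -> 0 < t ->
    dsolid_other x y z t * (y * h) = - weight x y z t * x * h.
  by move=> *; rewrite mulrA dsolid_otherE.
rewrite !hS// !hO// /weight_bil.
rewrite (weightC12 b a) (weightC12 c a) (weightC12 d a) (weightC12 c b) (weightC12 d
  b) (weightC12 d c).
have [an bn cn dn] : [/\ a != 0, b != 0, c != 0 & d != 0] by rewrite !gt_eqF.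
move: (weight _ _ _ _) (weight _ _ _ _) (weight _ _ _ _) (weight _ _ _ _) (weight _
  _ _ _) (weight _ _ _ _) => w1 w2 w3 w4 w5 w6.
by field; rewrite an bn cn dn.
Qed.

End Tetrahedron.

(** * Strict differentiability *)

Section RowVectors.
Variables (R : realType) (n : nat).
Implicit Types (u v g : 'rV[R]_n).

Definition dotv u v : R := \sum_i u 0 i * v 0 i.

Lemma dotvDl u v w : dotv (u + v) w = dotv u w + dotv v w.
Proof. by rewrite /dotv -big_split; apply: eq_bigr => i _; rewrite mxE mulrDl. Qed.
Lemma dotvZl a u v : dotv (a *: u) v = a * dotv u v.
Proof. by rewrite /dotv mulr_sumr; apply: eq_bigr => i _; rewrite mxE mulrA. Qed.
Lemma dotvC u v : dotv u v = dotv v u.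
Proof. by apply: eq_bigr => i _; rewrite mulrC. Qed.
Lemma dotv0l v : dotv 0 v = 0.
Proof. by rewrite /dotv big1// => i _; rewrite mxE mul0r. Qed.
Lemma dotvNl u v : dotv (- u) v = - dotv u v.
Proof. by rewrite -scaleN1r dotvZl mulN1r. Qed.
Lemma dotvDr u v w : dotv w (u + v) = dotv w u + dotv w v.
Proof. by rewrite !(dotvC w) dotvDl. Qed.
Lemma dotvZr a u v : dotv v (a *: u) = a * dotv v u.
Proof. by rewrite !(dotvC v) dotvZl. Qed.
Lemma dotvNr u v : dotv v (- u) = - dotv v u.
Proof. by rewrite !(dotvC v) dotvNl. Qed.
Lemma dotv_suml (I : Type) (s : seq I) (P : pred I) (F : I -> 'rV[R]_n) v :
  dotv (\sum_(i <- s | P i) F i) v = \sum_(i <- s | P i) dotv (F i) v.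
Proof.
elim/big_rec2: _ => [|i a b _ <-]; [exact: dotv0l|exact: dotvDl].
Qed.
Lemma dotv_delta i v : dotv (delta_mx 0 i) v = v 0 i.
Proof.
rewrite /dotv (bigD1 i)//= big1 ?addr0 => [|j /negPf ji]; rewrite !mxE eqxx/=.
  by rewrite eqxx mul1r.
by rewrite ji mul0r.
Qed.

Lemma norm_le_coord v e : 0 <= e -> (forall i, `|v 0 i| <= e) -> `|v| <= e.
Proof.
move=> e0 h; rewrite /Num.norm/= mx_normrE; apply/bigmax_leP; split=> //= -[i j] _ /=.
by rewrite ord1; exact: h.
Qed.

Lemma coord_le_norm v i : `|v 0 i| <= `|v|.
Proof. by rewrite [leRHS]/Num.norm/= mx_normrE; exact: (le_bigmax _ _ (0, i)). Qed.

Lemma dotv_le_norm g v : `|dotv g v| <= (\sum_i `|g 0 i|) * `|v|.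
Proof.
apply: (le_trans (ler_norm_sum _ _ _)); rewrite mulr_suml ler_sum// => i _.
by rewrite normrM ler_wpM2l// coord_le_norm.
Qed.

Lemma nbhs_rVP v (U : set 'rV[R]_n) :
  nbhs v U <-> exists2 d, 0 < d & forall u, `|u - v| < d -> U u.
Proof.
split => [/nbhs_normP[d /= d0 h]|[d d0 h]].
  by exists d => // y yv; apply: h; rewrite /= distrC.
apply: filterS (nbhsx_ballx v d d0) => y; rewrite mx_norm_ball /ball_/= distrC.
exact: h.
Qed.

End RowVectors.

Section StrictDifferentiability.
Variable R : realType.

Definition sdiff1 (phi : R -> R) (x l : R) := forall e, 0 < e ->
  exists2 U, nbhs x U & forall y z, U y -> U z ->
    `|phi y - phi z - l * (y - z)| <= e * `|y - z|.

Definition sdiff n (f : 'rV[R]_n -> R) (x g : 'rV[R]_n) := forall e, 0 < e ->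
  exists2 U, nbhs x U & forall y z, U y -> U z ->
    `|f y - f z - dotv g (y - z)| <= e * `|y - z|.

(** The mean value theorem on the segment between the two points, which stays in a ball where [dphi]
    is within [e] of [dphi x]. *)
Lemma sdiff1_C1 (phi dphi : R -> R) (x : R) :
  (\forall y \near x, is_derive (y : R) 1 phi (dphi y)) -> {for x, continuous dphi} ->
  sdiff1 phi x (dphi x).
Proof.
move=> dphiP cdphi e e0.
have : \forall y \near x, is_derive (y : R) 1 phi (dphi y) /\ `|dphi x - dphi y| <= e.
  near=> y; split; first by near: y.
  by near: y; move/cvgrPdist_le : cdphi; exact.
move=> /nbhs_ballP[d /= d0 hd]; exists (ball x d); first exact: nbhsx_ballx.
have ord (y z : R) : ball x d y -> ball x d z -> y <= z ->
    `|phi z - phi y - dphi x * (z - y)| <= e * `|z - y|.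
  rewrite /ball/= => xy xz yz.
  have hB t : t \in `[y, z] -> ball x d t.
    rewrite in_itv/= => /andP[yt tz]; rewrite /ball/=.
    by move: xy xz; rewrite !ltr_distl => /andP[? ?] /andP[? ?]; apply/andP; lra.
  have [||t tI ->] := @MVT_segment R phi dphi y z yz.
  - by move=> t tI; have [|//] := hd t; apply: hB; move: tI;
    rewrite !in_itv/= => /andP[? ?]; rewrite !ltW.
  - apply: derivable_within_continuous => t /hB/hd[h _].
    exact: ex_derive.
  rewrite -mulrBl normrM ler_wpM2r//.
  by have [_] := hd t (hB t tI); rewrite distrC.
move=> y z Uy Uz; case: (leP z y) => zy; first exact: ord.
have -> : phi y - phi z - dphi x * (y - z) = - (phi z - phi y - dphi x * (z - y)) by ring.
by rewrite normrN (distrC y z); apply: ord => //; exact: ltW.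
Unshelve. all: by end_near. Qed.

Variable n : nat.
Implicit Types (f : 'rV[R]_n -> R) (x g : 'rV[R]_n).

Lemma sdiff_lipschitz f x g : sdiff f x g ->
  exists2 U, nbhs x U & forall y z, U y -> U z ->
    `|f y - f z| <= (\sum_i `|g 0 i| + 1) * `|y - z|.
Proof.
move=> /(_ 1 ltr01)[U xU hU]; exists U => // y z Uy Uz.
rewrite mulrDl [leRHS]addrC mul1r -[f y - f z](subrK (dotv g (y - z))).
apply: (le_trans (ler_normD _ _)); by rewrite lerD ?dotv_le_norm//;
  have := hU _ _ Uy Uz; rewrite mul1r.
Qed.

Lemma sdiff_continuous f x g : sdiff f x g -> {for x, continuous f}.
Proof.
move=> /sdiff_lipschitz[U xU]; set C := (_ + 1) => hU.
have C0 : 0 < C by rewrite ltr_wpDl// sumr_ge0.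
have FF : Filter (nbhs x) := nbhs_filter x.
apply/(cvgrPdist_le (FF := FF)) => /= e e0.
have : \forall y \near x, `|x - y| < e / C
  by apply/nbhs_rVP; exists (e / C); [rewrite divr_gt0|move=> y; rewrite distrC].
move=> h; near=> y.
apply: (le_trans (hU _ _ _ _)); [exact: nbhs_singleton|by near: y|].
by rewrite mulrC -ler_pdivlMr// ltW//; near: y.
Unshelve. all: by end_near. Qed.

Lemma sdiff_near f f' x g : (\forall y \near x, f y = f' y) ->
  sdiff f x g -> sdiff f' x g.
Proof.
move=> ff' df e e0; have [U xU hU] := df e e0.
exists (U `&` [set y | f y = f' y]); first exact: filterI.
by move=> y z [Uy /= <-] [Uz /= <-]; exact: hU.
Qed.

Lemma sdiff_comp (phi : R -> R) l f x g : sdiff1 phi (f x) l -> sdiff f x g ->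
  sdiff (phi \o f) x (l *: g).
Proof.
move=> dphi df e e0.
have [V xV hV] := sdiff_lipschitz df; set C := (_ + 1) in hV.
have C0 : 0 < C by rewrite ltr_wpDl// sumr_ge0.
have [W xW hW] := dphi (e / 2 / C) (divr_gt0 (divr_gt0 e0 (ltr0Sn _ 1)) C0).
have l0 : 0 < `|l| + 1 by rewrite ltr_wpDl.
have [U xU hU] := df (e / 2 / (`|l| + 1)) (divr_gt0 (divr_gt0 e0 (ltr0Sn _ 1)) l0).
exists (U `&` (V `&` f @^-1` W)).
  apply: filterI => //; apply: filterI => //.
  exact: (sdiff_continuous df).
move=> y z [Uy [Vy Wy]] [Uz [Vz Wz]] /=.
have -> : phi (f y) - phi (f z) - dotv (l *: g) (y - z) =
  (phi (f y) - phi (f z) - l * (f y - f z)) + l * (f y - f z - dotv g (y - z)).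
  by rewrite dotvZl; ring.
apply: (le_trans (ler_normD _ _)).
rewrite [e in leRHS](splitr e) mulrDl lerD//.
  apply: (le_trans (hW _ _ Wy Wz)).
  by rewrite -mulrA ler_pM2l ?divr_gt0// mulrC ler_pdivrMr// mulrC; exact: hV.
rewrite normrM.
have h1 := hU _ _ Uy Uz.
apply: (@le_trans _ _ ((`|l| + 1) * `|f y - f z - dotv g (y - z)|)).
  by rewrite ler_wpM2r// lerDl.
apply: (le_trans (ler_wpM2l (ltW l0) h1)).
by rewrite mulrA mulrCA mulfV ?gt_eqF// mulr1.
Qed.

Lemma sdiff_cst (k : R) x : sdiff (fun=> k) x 0.
Proof.
move=> e e0; exists setT; first exact: filterT.
by move=> y z _ _; rewrite dotv0l subrr subr0 normr0 mulr_ge0// ltW.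
Qed.

Lemma sdiff_coord i x : sdiff (fun y => y 0 i) x (delta_mx 0 i).
Proof.
move=> e e0; exists setT; first exact: filterT.
move=> y z _ _; rewrite dotv_delta !mxE subrr normr0.
by rewrite mulr_ge0// ltW.
Qed.

Lemma sdiff_dotv g x : sdiff (dotv g) x g.
Proof.
move=> e e0; exists setT; first exact: filterT.
by move=> y z _ _; rewrite dotvDr dotvNr subrr normr0 mulr_ge0// ltW.
Qed.

Lemma sdiffD f1 f2 x g1 g2 : sdiff f1 x g1 -> sdiff f2 x g2 ->
  sdiff (fun y => f1 y + f2 y) x (g1 + g2).
Proof.
move=> d1 d2 e e0.
have e20 : 0 < e / 2 by rewrite divr_gt0.
have [U xU hU] := d1 _ e20; have [V xV hV] := d2 _ e20.
exists (U `&` V); first exact: filterI.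
move=> y z [Uy Vy] [Uz Vz].
have -> : f1 y + f2 y - (f1 z + f2 z) - dotv (g1 + g2) (y - z) =
  (f1 y - f1 z - dotv g1 (y - z)) + (f2 y - f2 z - dotv g2 (y - z)).
  by rewrite dotvDl; ring.
apply: (le_trans (ler_normD _ _)).
by rewrite [e in leRHS](splitr e) mulrDl lerD// ?hU// hV.
Qed.

Lemma sdiff1_linear (k x : R) : sdiff1 ( *%R k) x k.
Proof.
move=> e e0; exists setT; first exact: filterT.
move=> y z _ _; rewrite -mulrBr subrr normr0 mulr_ge0// ltW//.
Qed.

Lemma sdiffZ k f x g : sdiff f x g -> sdiff (fun y => k * f y) x (k *: g).
Proof. by apply: sdiff_comp; exact: sdiff1_linear. Qed.

Lemma sdiffN f x g : sdiff f x g -> sdiff (fun y => - f y) x (- g).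
Proof.
move=> /(@sdiffZ (-1)); rewrite scaleN1r; apply: sdiff_near.
by near=> y; rewrite mulN1r.
Unshelve. all: by end_near. Qed.

Lemma sdiffB f1 f2 x g1 g2 : sdiff f1 x g1 -> sdiff f2 x g2 ->
  sdiff (fun y => f1 y - f2 y) x (g1 - g2).
Proof. by move=> d1 /sdiffN; exact: sdiffD. Qed.

Lemma sdiff_sum (I : Type) (s : seq I) (P : pred I) (F : I -> 'rV[R]_n -> R) G x :
  (forall i, P i -> sdiff (F i) x (G i)) ->
  sdiff (fun y => \sum_(i <- s | P i) F i y) x (\sum_(i <- s | P i) G i).
Proof.
move=> h; elim: s => [|i s ih].
  by rewrite big_nil; apply: sdiff_near (sdiff_cst 0 x); near=> y; rewrite big_nil.
rewrite big_cons; case: ifPn => Pi.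
  apply: sdiff_near (sdiffD (h i Pi) ih).
  by near=> y; rewrite big_cons Pi.
by apply: sdiff_near ih; near=> y; rewrite big_cons (negbTE Pi).
Unshelve. all: by end_near. Qed.

Lemma sdiff1_sqr (x : R) : sdiff1 (fun y => y ^+ 2) x (2 * x).
Proof.
apply: (@sdiff1_C1 _ (fun y => 2 * y)).
  near=> y; apply: is_derive_eq.
  by rewrite -[y%:A]/(y * 1); ring.
exact: mulrl_continuous.
Unshelve. all: by end_near. Qed.

(* By polarization, from the chain rule for squares. *)
Lemma sdiffM f1 f2 x g1 g2 : sdiff f1 x g1 -> sdiff f2 x g2 ->
  sdiff (fun y => f1 y * f2 y) x (f2 x *: g1 + f1 x *: g2).
Proof.
move=> d1 d2.
have ds := sdiff_comp (sdiff1_sqr _) (sdiffD d1 d2).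
have db := sdiff_comp (sdiff1_sqr _) (sdiffB d1 d2).
have := sdiffZ (4^-1) (sdiffB ds db).
set g := 4^-1 *: _; have -> : g = f2 x *: g1 + f1 x *: g2.
  by apply/rowP => i; rewrite /g !mxE; field.
by apply: sdiff_near; near=> y => /=; field.
Unshelve. all: by end_near. Qed.

Lemma sdiff1_inv (x : R) : x != 0 -> sdiff1 (fun y => y^-1) x (- x ^- 2).
Proof.
move=> x0; apply: (@sdiff1_C1 _ (fun y => - y ^- 2)).
  have : \forall y \near x, y != 0 by exact: (open_neq x0).
  apply: filterS => y y0; apply: is_derive_eq; first exact: is_deriveV.
  by rewrite scaler1.
apply: continuousN; apply: cvgV; first by rewrite expf_neq0.
exact: exprn_continuous.
Unshelve. all: by end_near. Qed.

Lemma sdiffV f x g : f x != 0 -> sdiff f x g ->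
  sdiff (fun y => (f y)^-1) x (- (f x) ^- 2 *: g).
Proof. by move=> fx0; apply: sdiff_comp; exact: sdiff1_inv. Qed.

Lemma sdiff1_sqrt (x : R) : 0 < x -> sdiff1 Num.sqrt x (2 * Num.sqrt x)^-1.
Proof.
move=> x0; apply: (@sdiff1_C1 _ (fun y => (2 * Num.sqrt y)^-1)).
  have : \forall y \near x, 0 < y by exact: lt_nbhsr.
  by apply: filterS => y y0; exact: is_derive1_sqrt.
apply: cvgV; first by rewrite mulf_neq0// gt_eqF// sqrtr_gt0.
by apply: cvgM; [exact: cvg_cst|exact: sqrt_continuous].
Unshelve. all: by end_near. Qed.

Lemma sdiff1_acos (x : R) : -1 < x < 1 ->
  sdiff1 acos x (- (Num.sqrt (1 - x ^+ 2))^-1).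
Proof.
move=> /andP[x0 x1]; apply: (@sdiff1_C1 _ (fun y => - (Num.sqrt (1 - y ^+ 2))^-1)).
  near=> y; apply: is_derive1_acos; apply/andP; split; near: y;
    [exact: lt_nbhsr|exact: lt_nbhsl].
have ? : x ^+ 2 < 1 by rewrite expr2; nra.
apply: continuousN; apply: cvgV; first by rewrite gt_eqF// sqrtr_gt0 subr_gt0.
apply: (@cvg_comp _ _ _ (fun y => 1 - y ^+ 2) Num.sqrt); last exact: sqrt_continuous.
by apply: cvgB; [exact: cvg_cst|exact: exprn_continuous].
Unshelve. all: by end_near. Qed.

Lemma sdiff1_powR (p x : R) : 0 < x -> sdiff1 (fun y => y `^ p) x (p * x `^ (p - 1)).
Proof.
move=> x0; apply: (@sdiff1_C1 _ (fun y => p * y `^ (p - 1))).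
  have : \forall y \near x, 0 < y by exact: lt_nbhsr.
  by apply: filterS => y y0; exact: is_derive1_powR.
apply: cvgM; first exact: cvg_cst.
have /(@ex_derive _ _ _ _ _ _ _) := is_derive1_powR (p - 1) x0.
by move=> /derivable1_diffP/differentiable_continuous.
Unshelve. all: by end_near. Qed.

Lemma sdiff1_ln (x : R) : 0 < x -> sdiff1 (@ln R) x x^-1.
Proof.
move=> x0; apply: (@sdiff1_C1 _ (fun y => y^-1)).
  have : \forall y \near x, 0 < y by exact: lt_nbhsr.
  by apply: filterS => y y0; exact: is_derive1_ln.
by apply: inv_continuous; rewrite gt_eqF.
Unshelve. all: by end_near. Qed.

(** Identifies the gradients computed here with the directional derivatives that define [Lambda]. *)
Lemma sdiff_derive f x g v : sdiff f x g -> 'D_v f x = dotv g v.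
Proof.
move=> df; apply/cvg_lim => //; apply/cvgrPdist_le => /= e e0.
have v0 : 0 < `|v| + 1 by rewrite ltr_wpDl.
have [U xU hU] := df _ (divr_gt0 e0 v0).
have hU' : \forall h \near 0^', U (h *: v + x).
  apply: cvg_within; rewrite nbhs_filterE.
  have : (h *: v + x) @[h --> (0:R)] --> x.
    rewrite -[X in _ --> X]add0r -(scale0r v); apply: cvgD; last exact: cvg_cst.
    exact: cvgZr_tmp.
  exact.
near=> h.
have h0 : h != 0 by near: h; exact: nbhs_dnbhs_neq.
have := hU (h *: v + x) x; rewrite addrK dotvZr => /(_ _ _).
move=> /(_ ltac:(near: h; exact: hU') (nbhs_singleton xU)) hh.
rewrite distrC /= -[_ *: _]/(h^-1 * _).
have -> : h^-1 * (f (h *: v + x) - f x) - dotv g v =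
    h^-1 * (f (h *: v + x) - f x - h * dotv g v) by field.
rewrite normrM normfV ler_pdivrMl ?normr_gt0//.
apply: (le_trans hh); rewrite normrZ mulrCA ler_wpM2l//.
by rewrite mulrAC ler_pdivrMr// ler_wpM2l ?lerDl// ltW.
Unshelve. all: by end_near. Qed.

(* [V W - U^2] is the Gram determinant of the two vectors spanning the angle. *)
Lemma sdiff_angle U V W x gU gV gW :
  0 < V x -> 0 < W x -> 0 < V x * W x - U x ^+ 2 ->
  sdiff U x gU -> sdiff V x gV -> sdiff W x gW ->
  sdiff (fun y => acos (U y / (Num.sqrt (V y) * Num.sqrt (W y)))) x
    (- (Num.sqrt (V x * W x - U x ^+ 2))^-1 *:
      (gU - (U x / (2 * V x)) *: gV - (U x / (2 * W x)) *: gW)).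
Proof.
move=> V0 W0 G0 dU dV dW.
have sV0 : 0 < Num.sqrt (V x) by rewrite sqrtr_gt0.
have sW0 : 0 < Num.sqrt (W x) by rewrite sqrtr_gt0.
have dsV := sdiff_comp (sdiff1_sqrt V0) dV.
have dsW := sdiff_comp (sdiff1_sqrt W0) dW.
have dsVW := sdiffM dsV dsW.
have dsI := sdiffV (lt0r_neq0 (mulr_gt0 sV0 sW0)) dsVW.
have dq := sdiffM dU dsI.
set c := U x / (Num.sqrt (V x) * Num.sqrt (W x)).
have c2 : 1 - c ^+ 2 = (V x * W x - U x ^+ 2) / (V x * W x).
  rewrite /c expr_div_n exprMn !sqr_sqrtr ?ltW//; field.
  by rewrite !gt_eqF.
have c1 : -1 < c < 1.
  have : 0 < 1 - c ^+ 2 by rewrite c2 divr_gt0// mulr_gt0.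
  by move=> h; apply/andP; split; nra.
have := sdiff_comp (sdiff1_acos c1) dq.
set g := _ *: (_ + _); rewrite (_ : g = - (Num.sqrt (V x * W x - U x ^+ 2))^-1 *:
      (gU - (U x / (2 * V x)) *: gV - (U x / (2 * W x)) *: gW))//.
rewrite {}/g c2 sqrtrM ?ltW// sqrtrV ?mulr_ge0 ?ltW// sqrtrM ?ltW//.
have sG0 : 0 < Num.sqrt (V x * W x - U x ^+ 2) by rewrite sqrtr_gt0.
have eV : V x = Num.sqrt (V x) ^+ 2 by rewrite sqr_sqrtr// ltW.
have eW : W x = Num.sqrt (W x) ^+ 2 by rewrite sqr_sqrtr// ltW.
move: (Num.sqrt (_ - _)) sG0 => s s0 /=.
rewrite ![_ / (2 * V x)](congr1 (fun t => _ / (2 * t)) eV).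
rewrite ![_ / (2 * W x)](congr1 (fun t => _ / (2 * t)) eW).
move: (Num.sqrt (V x)) (Num.sqrt (W x)) sV0 sW0 => v w v0 w0.
apply/rowP => i; rewrite !mxE; field.
by rewrite !gt_eqF.
Qed.

End StrictDifferentiability.

(** * Gradient of the solid angles *)

Section SolidAngle.
Variables (R : realType) (N : nat).
Implicit Types (r : 'rV[R]_N) (i j k l : 'I_N).

Lemma edge_dot_perpE r i j k l :
  0 < r 0 i -> 0 < r 0 j -> 0 < r 0 k -> 0 < r 0 l ->
  j != k -> j != l -> k != l ->
  let a := (r 0 i)^-1 in let b := (r 0 j)^-1 in
  let c := (r 0 k)^-1 in let d := (r 0 l)^-1 in
  edge_dot_perp r i j k l = cosnum a b c d * (2 / (c * d * (a + b) ^+ 2)).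
Proof.
move=> i0 j0 k0 l0 jk jl kl a b c d.
rewrite /edge_dot_perp /edge_dot /edge_length eqxx (negbTE kl) (negbTE jl) (negbTE jk).
rewrite /cosnum /a /b /c /d; field.
by rewrite !gt_eqF// addr_gt0.
Qed.

Lemma edge_dot_perp_diagE r i j k :
  0 < r 0 i -> 0 < r 0 j -> 0 < r 0 k -> j != k ->
  let a := (r 0 i)^-1 in let b := (r 0 j)^-1 in let c := (r 0 k)^-1 in
  edge_dot_perp r i j k k = 2 * sym2 a b c * (2 / (c * (a + b)) ^+ 2).
Proof.
move=> i0 j0 k0 jk a b c.
rewrite /edge_dot_perp /edge_dot /edge_length !eqxx (negbTE jk).
rewrite /sym2 /a /b /c; field.
by rewrite !gt_eqF// addr_gt0.
Qed.

Lemma dihedralE r i j k l :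
  0 < r 0 i -> 0 < r 0 j -> 0 < r 0 k -> 0 < r 0 l ->
  j != k -> j != l -> k != l ->
  let a := (r 0 i)^-1 in let b := (r 0 j)^-1 in
  let c := (r 0 k)^-1 in let d := (r 0 l)^-1 in
  dihedral r i j k l =
  acos (cosnum a b c d / (Num.sqrt (2 * sym2 a b c) * Num.sqrt (2 * sym2 a b d))).
Proof.
move=> i0 j0 k0 l0 jk jl kl a b c d; rewrite /dihedral; congr acos.
rewrite edge_dot_perpE// !edge_dot_perp_diagE// -/a -/b -/c -/d.
have [a0 b0 c0 d0] : [/\ 0 < a, 0 < b, 0 < c & 0 < d] by rewrite !invr_gt0.
have ab0 : 0 < a + b by rewrite addr_gt0.
have P0 : 0 < 2 * sym2 a b c by rewrite mulr_gt0// !addr_gt0// mulr_gt0.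
have P'0 : 0 < 2 * sym2 a b d by rewrite mulr_gt0// !addr_gt0// mulr_gt0.
have sE (u v : R) : 0 < u -> 0 < v -> Num.sqrt (v * (2 / u ^+ 2)) =
  Num.sqrt v * (Num.sqrt 2 / u).
  move=> u0 v0; rewrite !sqrtrM// ?ltW//; congr (_ * (_ * _)).
  by rewrite sqrtrV ?sqr_ge0// sqrtr_sqr gtr0_norm.
rewrite sE ?(mulr_gt0 c0 ab0)// sE ?(mulr_gt0 d0 ab0)//.
have s2 : Num.sqrt 2 * Num.sqrt 2 = 2 :> R by rewrite -expr2 sqr_sqrtr.
have s20 : 0 < Num.sqrt 2 :> R by rewrite sqrtr_gt0.
have sP0 : 0 < Num.sqrt (2 * sym2 a b c) by rewrite sqrtr_gt0.
have sP'0 : 0 < Num.sqrt (2 * sym2 a b d) by rewrite sqrtr_gt0.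
rewrite -[X in X / (c * d * _)]s2.
move: (Num.sqrt 2) (Num.sqrt (_ * sym2 a b c)) (Num.sqrt (_ * sym2 a b d)) s20 sP0
  sP'0 => s p p' s0 p0 p'0.
field.
by rewrite !gt_eqF.
Qed.

Lemma sdiff_cosnum (A B C D : 'rV[R]_N -> R) x gA gB gC gD :
  sdiff A x gA -> sdiff B x gB -> sdiff C x gC -> sdiff D x gD ->
  let a := A x in let b := B x in let c := C x in let d := D x in
  sdiff (fun y => cosnum (A y) (B y) (C y) (D y)) x
    ((c + d - 2 * a) *: gA + (c + d - 2 * b) *: gB + (a + b) *: gC + (a + b) *: gD).
Proof.
move=> dA dB dC dD a b c d.
have := sdiffB (sdiffB (sdiffM (sdiffD dA dB) (sdiffD dC dD)) (sdiffM dA dA))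
  (sdiffM dB dB).
set g := (X in sdiff _ _ X) => dg.
rewrite (_ : (_ + _ : 'rV_N) = g); last first.
  by apply/rowP => m; rewrite /g /a /b /c /d !mxE; ring.
apply: sdiff_near dg; near=> y; rewrite /cosnum; ring.
Unshelve. all: by end_near. Qed.

Lemma sdiff_sym2 (A B C : 'rV[R]_N -> R) x gA gB gC :
  sdiff A x gA -> sdiff B x gB -> sdiff C x gC ->
  let a := A x in let b := B x in let c := C x in
  sdiff (fun y => 2 * sym2 (A y) (B y) (C y)) x
    ((2 * (b + c)) *: gA + (2 * (a + c)) *: gB + (2 * (a + b)) *: gC).
Proof.
move=> dA dB dC a b c.
have := sdiffZ 2 (sdiffD (sdiffD (sdiffM dA dB) (sdiffM dB dC)) (sdiffM dC dA)).
set g := (X in sdiff _ _ X) => dg.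
rewrite (_ : (_ + _ : 'rV_N) = g); last first.
  by apply/rowP => m; rewrite /g /a /b /c !mxE; ring.
exact: dg.
Qed.

Variable r0 : 'rV[R]_N.
Hypothesis r0_gt0 : forall i, 0 < r0 0 i.

Let dinv i : 'rV[R]_N := - (r0 0 i) ^- 2 *: delta_mx 0 i.

Lemma nbhs_pos : nbhs r0 [set r : 'rV[R]_N | forall i, 0 < r 0 i].
Proof.
exists (fun _ _ => [set u | 0 < u]) => [i j|r h i]; last exact: h.
by rewrite ord1; exact: lt_nbhsr.
Qed.

Let a_ i := (r0 0 i)^-1.

Lemma sdiff_dihedral i j k l : j != k -> j != l -> k != l ->
  let a := a_ i in let b := a_ j in let c := a_ k in let d := a_ l in
  0 < descartes a b c d ->
  sdiff (fun r => dihedral r i j k l) r0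
    ((Num.sqrt (descartes a b c d))^-1 *:
     (dangle_near a b c d *: dinv i + dangle_near b a c d *: dinv j +
      dangle_far a b c d *: dinv k + dangle_far a b d c *: dinv l)).
Proof.
move=> jk jl kl a b c d Q0.
have [a0 b0 c0 d0] : [/\ 0 < a, 0 < b, 0 < c & 0 < d] by rewrite !invr_gt0.
have dI m : sdiff (fun r : 'rV_N => (r 0 m)^-1) r0 (dinv m).
  by apply: sdiffV; [rewrite gt_eqF|exact: sdiff_coord].
have P0 : 0 < sym2 a b c by rewrite !addr_gt0// mulr_gt0.
have P'0 : 0 < sym2 a b d by rewrite !addr_gt0// mulr_gt0.
have ab0 : 0 < a + b by rewrite addr_gt0.
have dU := sdiff_cosnum (dI i) (dI j) (dI k) (dI l).
have dV := sdiff_sym2 (dI i) (dI j) (dI k).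
have dW := sdiff_sym2 (dI i) (dI j) (dI l).
have := sdiff_angle _ _ _ dU dV dW; rewrite /= -![(r0 0 _)^-1]/(a_ _) -/a -/b -/c -/d.
(* The Gram condition of [sdiff_angle] becomes Q (a + b)^2 > 0, and its square root supplies the
   factor sqrt Q. *)
rewrite descartes_gram => /(_ _ _ _).
move=> /(_ ltac:(by rewrite mulr_gt0) ltac:(by rewrite mulr_gt0) ltac:(by rewrite
  mulr_gt0// exprn_gt0)) dA.
set g := (X in sdiff _ _ X).
apply: (@sdiff_near _ _ (fun r => acos (cosnum (r 0 i)^-1 (r 0 j)^-1 (r 0 k)^-1 (r 0
  l)^-1 / (Num.sqrt (2 * sym2 (r 0 i)^-1 (r 0 j)^-1 (r 0 k)^-1) * Num.sqrt (2 * sym2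
    (r 0 i)^-1 (r 0 j)^-1 (r 0 l)^-1))))).
  by apply: filterS nbhs_pos => r rp; rewrite dihedralE.
move: dA; set g' := (X in sdiff _ _ X -> _).
suff -> : g = g' by [].
rewrite /g /g' sqrtrM ?ltW// sqrtr_sqr gtr0_norm// invfM.
have sQ0 : Num.sqrt (descartes a b c d) != 0 by rewrite gt_eqF// sqrtr_gt0.
move: (Num.sqrt _) sQ0 => s s0.
rewrite /dangle_near /dangle_far; move: (dinv i) (dinv j) (dinv k) (dinv l) =>
  di dj dk dl.
have e1 : cosnum b a c d = cosnum a b c d by rewrite /cosnum; ring.
have e2 : sym2 b a c = sym2 a b c by rewrite /sym2; ring.
have e3 : sym2 b a d = sym2 a b d by rewrite /sym2; ring.
(* The chain rule gives [dinv k] the coefficient (a + b) (1 - [cosnum] / (2 [sym2 a b c])); this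
   identity, and the next one for l, bring it to the form of [dangle_far]. *)
have e4 : (a + b) * (a + b + c - d) = 2 * sym2 a b c - cosnum a b c d by rewrite
  /sym2 /cosnum; ring.
have e5 : (a + b) * (a + b + d - c) = 2 * sym2 a b d - cosnum a b c d by rewrite
  /sym2 /cosnum; ring.
rewrite e1 e2 e3 e4 e5.
move: (cosnum a b c d) (sym2 a b c) (sym2 a b d) P0 P'0 => nn P P' P0 P'0.
apply/rowP => m; rewrite !mxE; field.
by rewrite s0 !gt_eqF.
Qed.

Lemma sdiff_solid_angle i j k l : j != k -> j != l -> k != l ->
  let a := a_ i in let b := a_ j in let c := a_ k in let d := a_ l in
  0 < descartes a b c d ->
  sdiff (fun r => solid_angle r i j k l) r0
    ((Num.sqrt (descartes a b c d))^-1 *: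
     (dsolid_self a b c d *: dinv i + dsolid_other a b c d *: dinv j +
      dsolid_other a c b d *: dinv k + dsolid_other a d b c *: dinv l)).
Proof.
move=> jk jl kl a b c d Q0.
have e1 : descartes a c d b = descartes a b c d by rewrite /descartes; ring.
have e2 : descartes a d b c = descartes a b c d by rewrite /descartes; ring.
have d1 := @sdiff_dihedral i j k l jk jl kl Q0.
have [kj lj lk] : [/\ k != j, l != j & l != k] by rewrite !(eq_sym _ j) (eq_sym l).
have /= := @sdiff_dihedral i k l j kl kj lj.
rewrite -/a -/b -/c -/d e1 => /(_ Q0) d2.
have /= := @sdiff_dihedral i l j k lj lk jk.
rewrite -/a -/b -/c -/d e2 => /(_ Q0) d3.
have := sdiffB (sdiffD (sdiffD d1 d2) d3) (sdiff_cst pi r0).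
rewrite -/a -/b -/c -/d.
set g := (X in sdiff _ _ X); set g' := (X in _ -> sdiff _ _ X).
suff -> : g = g' by [].
rewrite /g /g' /dsolid_self /dsolid_other.
rewrite (dangle_nearC34 c a d b) (dangle_nearC34 d a b c) (dangle_nearC34 d a c b).
by apply/rowP => m; rewrite !mxE; ring.
Qed.

(** Removing a vertex keeps the order of the others, which fixes the argument order of the four
    solid angles in [tetra_gradient]. *)
Lemma enum_setD1 (s : {set 'I_N}) i : enum (s :\ i)%SET = [seq x <- enum s | x != i].
Proof.
rewrite /enum_mem -filter_predI; apply: eq_filter => x /=.
by rewrite !inE.
Qed.

Lemma enum_card4 (s : {set 'I_N}) : #|s| = 4%N ->
  exists i j k l, enum s = [:: i; j; k; l] /\
    [/\ i != j, i != k & i != l] /\ [/\ j != k, j != l & k != l].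
Proof.
rewrite cardE; case E : (enum s) => [|i [|j [|k [|l []]]]]//= _.
exists i, j, k, l; split => //.
have := enum_uniq s; rewrite E /= !inE !negb_or => /and4P[/and3P[? ? ?] /andP[? ?] ? _].
by [].
Qed.

(** [F] is - [weight_bil] / sqrt Q in the quotients z_i / r_i: symmetry, sign and the equality case
    come from the weights, and [r0] is in the kernel because all its quotients are 1. *)
Lemma tetra_gradient (s : {set 'I_N}) : #|s| = 4%N -> 0 < Q r0 s ->
  exists G : 'I_N -> 'rV[R]_N,
  let F (z z' : 'rV[R]_N) := \sum_(m in s) z 0 m * dotv (G m) z' in
  [/\ forall m, m \in s -> sdiff (fun r => solid_angle_at r s m) r0 (G m),
      forall z z', F z z' = F z' z,
      forall z, F z r0 = 0,
      forall z, F z z <= 0 &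
      forall z, F z z = 0 ->
        {in s &, forall m m', z 0 m / r0 0 m = z 0 m' / r0 0 m'}].
Proof.
move=> s4 Q0; have [i [j [k [l [sE [[ij ik il] [jk jl kl]]]]]]] := enum_card4 s4.
have sumE (f : 'I_N -> R) : \sum_(m in s) f m = f i + f j + f k + f l.
  by rewrite -big_enum/= sE !big_cons big_nil addr0 !addrA.
have inE4 m : (m \in s) = (m \in [:: i; j; k; l]) by rewrite -sE mem_enum.
pose a := a_ i; pose b := a_ j; pose c := a_ k; pose d := a_ l.
have [a0 b0 c0 d0] : [/\ 0 < a, 0 < b, 0 < c & 0 < d] by rewrite !invr_gt0.
have QE : Q r0 s = descartes a b c d.
  by rewrite /Q !sumE /descartes /a /b /c /d /a_ -!exprVn.
have D0 : 0 < descartes a b c d by rewrite -QE.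
have [ji ki li] : [/\ j != i, k != i & l != i] by rewrite !(eq_sym _ i).
have [kj lj lk] : [/\ k != j, l != j & l != k] by rewrite !(eq_sym _ j) (eq_sym l).
have dperm2 : descartes b a c d = descartes a b c d by rewrite /descartes; ring.
have dperm3 : descartes c a b d = descartes a b c d by rewrite /descartes; ring.
have dperm4 : descartes d a b c = descartes a b c d by rewrite /descartes; ring.
have d1 := @sdiff_solid_angle i j k l jk jl kl D0.
have /= := @sdiff_solid_angle j i k l ik il kl.
rewrite -/a -/b -/c -/d dperm2 => /(_ D0) d2.
have /= := @sdiff_solid_angle k i j l ij il jl.
rewrite -/a -/b -/c -/d dperm3 => /(_ D0) d3.
have /= := @sdiff_solid_angle l i j k ij ik jk.
rewrite -/a -/b -/c -/d dperm4 => /(_ D0) d4.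
rewrite /= -/a -/b -/c -/d in d1.
move: d1 d2 d3 d4; set g1 := (_ *: _); set g2 := (_ *: (dsolid_self b _ _ _ *: _ +
  _ + _ + _)).
set g3 := (_ *: (dsolid_self c _ _ _ *: _ + _ + _ + _)).
set g4 := (_ *: (dsolid_self d _ _ _ *: _ + _ + _ + _)) => d1 d2 d3 d4.
(* Indices outside [s] also receive [g4], but [F] sums over [s] only. *)
pose G m := if m == i then g1 else if m == j then g2 else if m == k then g3 else g4.
have Gi : G i = g1 by rewrite /G eqxx.
have Gj : G j = g2 by rewrite /G (negbTE ji) eqxx.
have Gk : G k = g3 by rewrite /G (negbTE ki) (negbTE kj) eqxx.
have Gl : G l = g4 by rewrite /G (negbTE li) (negbTE lj) (negbTE lk).
have FE z z' : \sum_(m in s) z 0 m * dotv (G m) z' =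
  - (Num.sqrt (descartes a b c d))^-1 * weight_bil a b c d
    (z 0 i * a) (z 0 j * b) (z 0 k * c) (z 0 l * d)
    (z' 0 i * a) (z' 0 j * b) (z' 0 k * c) (z' 0 l * d).
  rewrite sumE Gi Gj Gk Gl -solid_bilinear// /g1 /g2 /g3 /g4.
  have dd m : dotv (dinv m) z' = - (a_ m * (z' 0 m * a_ m)).
    by rewrite /dinv dotvZl dotv_delta /a_ -exprVn; ring.
  rewrite !(dotvZl, dotvDl, dd) -/a -/b -/c -/d.
  rewrite !mulfK ?gt_eqF//.
  move: (_^-1) (dsolid_self _ _ _ _) (dsolid_self _ _ _ _) (dsolid_self _ _ _ _)
    (dsolid_self _ _ _ _) => q e1 e2 e3 e4.
  by ring.
have sQ0 : 0 < (Num.sqrt (descartes a b c d))^-1 by rewrite invr_gt0 sqrtr_gt0.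
exists G => /=; split.
- move=> m; rewrite inE4 !inE /solid_angle_at enum_setD1 sE => /or4P[]/eqP->/=;
   rewrite !eqxx ?ij ?ik ?il ?ji ?jk ?jl ?ki ?kj ?kl ?li ?lj ?lk/= ?Gi ?Gj ?Gk ?Gl//.
- move=> z z'; rewrite !FE /weight_bil; ring.
- move=> z; rewrite FE /weight_bil /a /b /c /d /a_ !mulfV ?gt_eqF// !subrr; ring.
- move=> z; rewrite FE weight_bilxx nmulr_rle0 ?oppr_lt0//.
  rewrite leNgt; apply/negP => lt0.
  have : ~ [/\ z 0 i * a = z 0 j * b, z 0 i * a = z 0 k * c & z 0 i * a = z 0 l * d].
    case=> h1 h2 h3; move: lt0; rewrite /weight_form /edge_form -h1 -h2 -h3 !subrr.
    by rewrite expr0n/= !mulr0 !addr0 ltxx.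
  by move=> /(weight_form_gt0 a0 b0 c0 d0 D0)/ltW; rewrite leNgt lt0.
- move=> z; rewrite FE weight_bilxx => /eqP.
  rewrite mulf_eq0 oppr_eq0 gt_eqF//= => /eqP w0.
  have [h1 h2 h3] : [/\ z 0 i * a = z 0 j * b, z 0 i * a = z 0 k * c & z 0 i * a =
    z 0 l * d].
    apply: contrapT => /(weight_form_gt0 a0 b0 c0 d0 D0).
    by rewrite w0 ltxx.
  have hm m : m \in s -> z 0 m / r0 0 m = z 0 i * a.
    by rewrite inE4 !inE => /or4P[]/eqP->; rewrite -?[RHS]/(z 0 i * a) // ?h1 ?h2 ?h3.
  by move=> m m' ms m's; rewrite !hm.
Qed.

End SolidAngle.

(** * The curvature and its Jacobian *)

(** A topological argument instead of a chain of adjacent tetrahedra. Let [H] be the total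
    barycentric weight of the vertices where [f] equals [f i0]. Each point lies in a tetrahedron, on
    which [f] is constant, so [H] is 0 or 1 there; transported to the connected M, the continuous
    [H] cannot take both values. *)
Lemma triangulation_connected (R : realType) (M : topologicalType) (N : nat)
    (T : {set {set 'I_N}}) (f : 'I_N -> R) :
  triangulated_3manifold R M T ->
  (forall s, s \in tetrahedra T -> {in s &, forall i j, f i = f j}) ->
  forall i j, f i = f j.
Proof.
move=> [mM cT [hom [g [_ cg homK gK]]]] fs i0 j0; apply: contrapT => fij.
pose H (x : 'rV[R]_N) := \sum_(i | f i == f i0) x 0 i.
have HC : continuous H.
  move=> x; apply: (@sdiff_continuous _ _ _ _ (\sum_(i | f i == f i0) delta_mx 0 i)).
  by apply: sdiff_sum => i _; exact: sdiff_coord.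
have gC : continuous g by apply/continuous_subspace_setT.
have hC : continuous (H \o g).
  by move=> m; apply: continuous_comp; [exact: gC|exact: HC].
have h01 m : (H \o g) m = 0 \/ (H \o g) m = 1.
  have [[g0 g1 gT] _] := gK m I.
  have [t [tT t4 st]] := s3c_pure cT gT.
  have tt : t \in tetrahedra T by rewrite inE tT t4 eqxx.
  have gt i : i \notin t -> g m 0 i = 0.
    move=> it; apply/eqP/negPn/negP => gi; case/negP: it.
    by apply: (fintype.subsetP st); rewrite inE.
  have [ft|ft] := boolP [exists i in t, f i == f i0].
    right; move/exists_inP : ft => [i it /eqP fi].
    rewrite /= /H -[RHS]g1 [RHS](bigID (fun i => f i == f i0))/=.
    rewrite [X in _ = _ + X]big1 ?addr0// => j fj; apply: gt.
    by apply: contra fj => jt; rewrite (fs _ tt j i jt it) fi.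
  left; rewrite /= /H big1// => i fi; apply: gt; apply: contra ft => it.
  by apply/exists_inP; exists i.
have hv j : exists m, (H \o g) m = (f j == f i0)%:R.
  have vj : realization T (delta_mx 0 j : 'rV[R]_N).
    split.
    - by move=> i; rewrite mxE; case: (_ && _).
    - by rewrite (bigD1 j)//= big1 ?addr0 => [|i /negPf ij]; rewrite mxE ?eqxx// ij.
    - rewrite (_ : [set _ | _]%SET = [set j]%SET); first exact: s3c_vertices.
      apply/setP => i; rewrite !inE mxE eqxx/=.
      by case: (i == j); rewrite ?oner_eq0 ?eqxx.
  have [_ gj] := homK _ vj; exists (hom (delta_mx 0 j)); rewrite /= gj /H.
  have [fj|fj] := boolP (f j == f i0).
    rewrite (bigD1 j)//= mxE !eqxx big1 ?addr0// => i /andP[_ /negPf ij].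
    by rewrite mxE ij andbF.
  rewrite big1// => i fi; rewrite mxE eqxx/=; case: (i =P j) => // ij.
  by move: fj; rewrite -ij fi.
have : connected [set (H \o g) x | x in [set: M]].
  apply: connected_continuous_connected; first exact: c3m_connected mM.
  exact: continuous_subspaceT hC.
move/connected_intervalP => itv.
have [m1 hm1] := hv i0; have [m0 hm0] := hv j0.
rewrite eqxx in hm1.
rewrite (_ : _ == _ = false) in hm0; last by apply/eqP => e; apply: fij.
have : [set (H \o g) x | x in [set: M]] (1 / 2).
  apply: (itv 0 1); [by exists m0|by exists m1|].
  by apply/andP; split; lra.
by case=> m _; case: (h01 m) => -> /eqP; [rewrite lt_eqF//|rewrite gt_eqF//]; lra.
Qed.

Section CurvatureGradient.
Variables (R : realType) (N : nat) (T : {set {set 'I_N}}) (r0 : 'rV[R]_N).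
Hypothesis r0M : ball_packing_metrics T r0.

Let r0_gt0 i : 0 < r0 0 i. Proof. by case: r0M. Qed.

(** [L] is the bilinear form of [Lambda]; exchanging the two sums makes it minus the sum of the
    forms of the tetrahedra. As these all have the same sign, [L z z = 0] forces each of them to
    vanish, but this yields proportionality to [r0] only within one tetrahedron;
    [triangulation_connected] makes it global. *)
Lemma curvature_gradient :
  exists dK : 'I_N -> 'rV[R]_N,
  let L (z z' : 'rV[R]_N) := \sum_i z 0 i * dotv (dK i) z' in
  [/\ forall i, sdiff (fun r => K T r i) r0 (dK i),
      forall z z', L z z' = L z' z,
      forall z, L z r0 = 0,
      forall z, 0 <= L z z &
      forall z, L z z = 0 -> forall s, s \in tetrahedra T ->
        {in s &, forall m m', z 0 m / r0 0 m = z 0 m' / r0 0 m'}].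
Proof.
have /choice[G GP] : forall s : {set 'I_N}, exists G : 'I_N -> 'rV[R]_N,
    s \in tetrahedra T ->
    let F (z z' : 'rV[R]_N) := \sum_(m in s) z 0 m * dotv (G m) z' in
  [/\ forall m, m \in s -> sdiff (fun r => solid_angle_at r s m) r0 (G m),
      forall z z', F z z' = F z' z,
      forall z, F z r0 = 0,
      forall z, F z z <= 0 &
      forall z, F z z = 0 ->
        {in s &, forall m m', z 0 m / r0 0 m = z 0 m' / r0 0 m'}].
  move=> s; case: (boolP (s \in tetrahedra T)) => [sT|_]; last by exists (fun=> 0).
  have s4 : #|s| = 4%N by move: (sT); rewrite inE => /andP[_ /eqP].
  have Qs : 0 < Q r0 s by case: r0M => _; exact.
  by have [G HG] := tetra_gradient r0_gt0 s4 Qs; exists G.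
exists (fun i => - \sum_(s in tetrahedra T | i \in s) G s i) => L.
pose F (s : {set 'I_N}) (z z' : 'rV[R]_N) := \sum_(m in s) z 0 m * dotv (G s m) z'.
have LE z z' : L z z' = - \sum_(s in tetrahedra T) F s z z'.
  rewrite /L /F (exchange_big_dep predT)//= -sumrN; apply: eq_bigr => i _.
  rewrite dotvNl mulrN dotv_suml mulr_sumr; congr (- _).
split.
- move=> i; rewrite /K.
  apply: (@sdiff_near _ _ (fun r => 4 * pi + - \sum_(s in tetrahedra T | i \in s)
    solid_angle_at r s i)).
    by near=> r.
  rewrite -[X in sdiff _ _ X]add0r; apply: sdiffD; first exact: sdiff_cst.
  apply: sdiffN; apply: sdiff_sum => s /andP[sT si].
  by have [+ _ _ _ _] := GP s sT; exact.
- move=> z z'; rewrite !LE; congr (- _); apply: eq_bigr => s sT.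
  by have [_ + _ _ _] := GP s sT; exact.
- move=> z; rewrite LE big1 ?oppr0// => s sT.
  by have [_ _ + _ _] := GP s sT; exact.
- move=> z; rewrite LE oppr_ge0 sumr_le0// => s sT.
  by have [_ _ _ + _] := GP s sT; exact.
- move=> z; rewrite LE -sumrN => /eqP.
  rewrite psumr_eq0 => [/allP h s sT|s sT]; last first.
    by rewrite oppr_ge0; have [_ _ _ + _] := GP s sT; exact.
  have [_ _ _ _] := GP s sT; apply; apply/eqP.
  by have := h s (mem_index_enum _); rewrite sT/= oppr_eq0.
Unshelve. all: by end_near. Qed.

End CurvatureGradient.

(** * Rayleigh quotients *)

Section QuadraticForms.
Variables (R : realType) (n : nat).
Implicit Types (z y : 'rV[R]_n).

Lemma sphere_compact : compact [set z : 'rV[R]_n | `|z| = 1].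
Proof.
apply: bounded_closed_compact.
  exists 1; split; first exact: real1.
  by move=> M M1 z /= ->; exact: ltW.
apply: (@preimage_closed _ _ (fun z : 'rV[R]_n => `|z|) [set 1]).
  by move=> z _; exact: norm_continuous.
exact: closed_eq.
Qed.

Lemma quad_coercive (q : 'rV[R]_n -> R) : continuous q ->
  (forall t z, q (t *: z) = t ^+ 2 * q z) -> (forall z, z != 0 -> 0 < q z) ->
  exists2 k, 0 < k & forall z, k * `|z| ^+ 2 <= q z.
Proof.
move=> qC qZ q0.
have q00 : q 0 = 0 by rewrite -(scale0r 0) qZ expr0n mul0r.
(* The sphere is empty when [n] is 0, and then every vector is 0. *)
have [[z1 Sz1]|S0] := pselect ([set z : 'rV[R]_n | `|z| = 1] !=set0); last first.
  exists 1 => // z; have [->|z0] := eqVneq z 0; first by rewrite normr0 q00 expr0n mulr0.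
  exfalso; apply: S0; exists (`|z|^-1 *: z) => /=.
  by rewrite normrZ normfV normr_id mulVf ?normr_eq0.
have [|z0 /set_mem /= z0S z0min] := EVT_min_rV (ex_intro _ z1 Sz1) sphere_compact (f
  := q).
  exact: continuous_subspaceT.
have z0N0 : z0 != 0 by rewrite -normr_eq0 z0S oner_eq0.
exists (q z0); first exact: q0.
move=> z; have [->|zN0] := eqVneq z 0; first by rewrite normr0 q00 expr0n mulr0.
have nz0 : 0 < `|z| by rewrite normr_gt0.
have := z0min (`|z|^-1 *: z); rewrite qZ exprVn mulrC ler_pdivlMr ?exprn_gt0//.
by apply; rewrite inE/= normrZ normfV normr_id mulVf ?gt_eqF.
Qed.

Variables (dK : 'I_n -> 'rV[R]_n).
Let L z y := \sum_i z 0 i * dotv (dK i) y.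

Lemma bil_sdiff z : exists g, sdiff (fun z => L z z) z g.
Proof.
eexists; apply: sdiff_sum => i _.
by apply: sdiffM; [exact: sdiff_coord|exact: sdiff_dotv].
Qed.

Lemma bilDl z z' y : L (z + z') y = L z y + L z' y.
Proof. by rewrite /L -big_split; apply: eq_bigr => i _; rewrite mxE mulrDl. Qed.
Lemma bilDr z z' y : L y (z + z') = L y z + L y z'.
Proof. by rewrite /L -big_split; apply: eq_bigr => i _; rewrite dotvDr mulrDr. Qed.
Lemma bilZl t z y : L (t *: z) y = t * L z y.
Proof. by rewrite /L mulr_sumr; apply: eq_bigr => i _; rewrite mxE mulrA. Qed.
Lemma bilZr t z y : L y (t *: z) = t * L y z.
Proof. by rewrite /L mulr_sumr; apply: eq_bigr => i _; rewrite dotvZr; ring. Qed.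

Variables (c : 'I_n -> R) (r0 : 'rV[R]_n).
Hypothesis c_gt0 : forall i, 0 < c i.
Hypothesis r0N0 : r0 != 0.
Hypothesis Lsym : forall z y, L z y = L y z.
Hypothesis Lker : forall z, L z r0 = 0.
Hypothesis Lge0 : forall z, 0 <= L z z.
Hypothesis Ldef : forall z, L z z = 0 -> exists t, z = t *: r0.

Let D z y := \sum_i c i * z 0 i * y 0 i.

Let DE z y : D z y = dotv (\row_i (c i * z 0 i)) y.
Proof. by apply: eq_bigr => i _; rewrite mxE. Qed.
Let Dsym z y : D z y = D y z.
Proof. by apply: eq_bigr => i _; ring. Qed.
Let DDr z z' y : D y (z + z') = D y z + D y z'.
Proof. by rewrite !DE dotvDr. Qed.
Let DZr t z y : D y (t *: z) = t * D y z.
Proof. by rewrite !DE dotvZr. Qed.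
Let DDl z z' y : D (z + z') y = D z y + D z' y.
Proof. by rewrite !(Dsym _ y) DDr. Qed.
Let DZl t z y : D (t *: z) y = t * D z y.
Proof. by rewrite !(Dsym _ y) DZr. Qed.
Let D_gt0 z : z != 0 -> 0 < D z z.
Proof.
move=> zN0; rewrite lt0r sumr_ge0 ?andbT => [|i _]; last first.
  by rewrite -mulrA mulr_ge0 ?(ltW (c_gt0 _))// -expr2 sqr_ge0.
rewrite psumr_eq0 => [|i _]; last first.
  by rewrite -mulrA mulr_ge0 ?(ltW (c_gt0 _))// -expr2 sqr_ge0.
apply: contra zN0 => /allP h; apply/eqP/rowP => i; rewrite mxE.
have := h i (mem_index_enum _); rewrite /= -mulrA mulf_eq0 gt_eqF//=.
by rewrite -expr2 sqrf_eq0 => /eqP.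
Qed.
Let D_sdiff z : exists g, sdiff (fun z => D z z) z g.
Proof.
eexists; apply: sdiff_sum => i _.
by apply: sdiffM; [apply: sdiffZ; exact: sdiff_coord|exact: sdiff_coord].
Qed.

Let D0_sdiff z : sdiff (fun z => D z r0) z (\row_i (c i * r0 0 i)).
Proof.
by apply: sdiff_near (sdiff_dotv _ _); near=> y; rewrite Dsym DE.
Unshelve. all: by end_near. Qed.

Lemma quad_ge0_lin0 (p q : R) : (forall t, 0 <= t * p + t ^+ 2 * q) -> p = 0.
Proof.
move=> h; apply: contrapT => /eqP pN0.
have q0 : 0 < `|q| + 1 by rewrite ltr_wpDl.
(* At this t, of sign opposite to p, the quadratic term is less than half the linear one in absolute
   value. *)
have := h (- p / (`|q| + 1) / 2).
have -> : - p / (`|q| + 1) / 2 * p + (- p / (`|q| + 1) / 2) ^+ 2 * q =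
   p ^+ 2 / (`|q| + 1) / 2 * (q / (`|q| + 1) / 2 - 1) by field; rewrite gt_eqF.
have p20 : 0 < p ^+ 2 / (`|q| + 1) / 2 by rewrite !divr_gt0// exprn_even_gt0.
rewrite pmulr_rge0// leNgt => /negP; apply.
rewrite subr_lt0 ltr_pdivrMr// ltr_pdivrMr//.
by have := ler_norm q; lra.
Qed.

(** [mu] is the minimum of [L y y / D y y] over the D-orthogonal complement of [r0], which [y1]
    shows to be nontrivial. The first variation at a minimizer [v] gives the eigenvalue equation
    against the complement; against [r0] both sides are 0, so it holds against every [z]. *)
Lemma rayleigh_min y1 : y1 != 0 -> D y1 r0 = 0 ->
  exists2 mu, 0 < mu &
    (forall y, D y r0 = 0 -> mu * D y y <= L y y) /\
    exists2 v, v != 0 & forall z, L v z = mu * D v z.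
Proof.
move=> y1N0 y1r.
pose A := [set z : 'rV[R]_n | `|z| = 1] `&` [set z | D z r0 = 0].
have Acpt : compact A.
  apply: compact_closedI; first exact: sphere_compact.
  apply: (@preimage_closed _ _ (fun z : 'rV[R]_n => D z r0) [set 0]);
    last exact: closed_eq.
  by move=> z _; exact: sdiff_continuous (D0_sdiff z).
have nrm y : y != 0 -> D y r0 = 0 -> A (`|y|^-1 *: y).
  move=> yN0 yr; split=> /=.
    by rewrite normrZ normfV normr_id mulVf ?normr_eq0.
  by rewrite DZl yr mulr0.
have [|v /set_mem[/= vS vr] vmin] := EVT_min_rV (ex_intro _ _ (nrm _ y1N0 y1r)) Acpt
  (f := fun z => L z z / D z z).
  apply/continuous_in_subspaceT => z /set_mem[/= zS _].
  have zN0 : z != 0 by rewrite -normr_eq0 zS oner_eq0.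
  have [g dL] := bil_sdiff z; have [g' dD] := D_sdiff z.
  have := sdiff_continuous (sdiffM dL (@sdiffV _ _ (fun z =>
    D z z) z g' (lt0r_neq0 (D_gt0 zN0)) dD)).
  exact.
have vN0 : v != 0 by rewrite -normr_eq0 vS oner_eq0.
pose mu := L v v / D v v.
have Lv : L v v = mu * D v v by rewrite /mu divfK// gt_eqF// D_gt0.
have mu0 : 0 < mu.
  rewrite divr_gt0 ?D_gt0// lt0r Lge0 andbT; apply/eqP => /Ldef[t vE].
  move: vr; rewrite vE DZl => /eqP; rewrite mulf_eq0 [D r0 r0 == 0]gt_eqF ?D_gt0// orbF.
  by move=> /eqP t0; move: vN0; rewrite vE t0 scale0r eqxx.
have muP y : D y r0 = 0 -> mu * D y y <= L y y.
  move=> yr; have [->|yN0] := eqVneq y 0.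
    by rewrite -(scale0r 0) DZl bilZl !mul0r mulr0.
  have := vmin (`|y|^-1 *: y); rewrite inE => /(_ (nrm _ yN0 yr)).
  rewrite -/mu DZl DZr bilZl bilZr -mulf_div mulfV ?invr_eq0 ?normr_eq0// mul1r.
  rewrite -mulf_div mulfV ?invr_eq0 ?normr_eq0// mul1r.
  by rewrite ler_pdivlMr// D_gt0.
exists mu => //; split=> //; exists v => // z.
have vE y : D y r0 = 0 -> L v y = mu * D v y.
  move=> yr.
  have : 2 * (L v y - mu * D v y) = 0.
    apply: (@quad_ge0_lin0 _ (L y y - mu * D y y)) => t.
    have := muP (v + t *: y); rewrite DDl DZl yr vr mulr0 addr0 => /(_ erefl).
    rewrite -subr_ge0 !(DDl, DDr, DZl, DZr, bilDl, bilDr, bilZl, bilZr).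
    rewrite (Dsym y v) (Lsym y v) Lv.
    by congr (_ <= _); ring.
  by move=> /eqP; rewrite mulf_eq0 pnatr_eq0/= subr_eq0 => /eqP.
pose t := D z r0 / D r0 r0.
have D00 : D r0 r0 != 0 by rewrite gt_eqF// D_gt0.
have yr : D (z + (- t) *: r0) r0 = 0 by rewrite DDl DZl /t mulNr divfK// subrr.
have := vE _ yr; rewrite bilDr bilZr Lker mulr0 addr0 => ->.
by rewrite DDr DZr vr mulr0 addr0.
Qed.

(** The bracket is the squared D-norm of the component of [z] that is D-orthogonal to [r0]. With c_i
    = r_i^(alpha - 1) and kappa = alpha s_alpha, this is the form B. *)
Definition linearized_form kappa z :=
  L z z - kappa * (D z z - D z r0 ^+ 2 / D r0 r0).

(** With y the D-orthogonal component of [z], the form is L y y - kappa D y y. In the spectral case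
    the minimal Rayleigh quotient is an eigenvalue, hence at least [lambda1]; in the other case
    positivity of L off its kernel suffices. *)
Lemma linearized_form_gt0 kappa :
  (exists2 lambda1, kappa < lambda1 &
     forall mu v, 0 < mu -> v != 0 -> (forall z, L v z = mu * D v z) -> lambda1 <= mu)
  \/ kappa <= 0 ->
  forall z, (forall t, z <> t *: r0) -> 0 < linearized_form kappa z.
Proof.
move=> Hk z zN; rewrite /linearized_form.
have D00 : 0 < D r0 r0 by rewrite D_gt0.
pose t := D z r0 / D r0 r0; pose y := z + (- t) *: r0.
have zE : z = y + t *: r0 by rewrite /y -addrA -scalerDl addNr scale0r addr0.
have yr : D y r0 = 0 by rewrite /y DDl DZl /t mulNr divfK ?subrr// gt_eqF.
have yN0 : y != 0 by apply/eqP => y0; apply: (zN t); rewrite {1}zE y0 add0r.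
have Ly : L z z = L y y.
  by rewrite zE bilDl !bilDr !bilZl !bilZr !Lker (Lsym r0) Lker !mulr0 !addr0.
have Dy : D z z - D z r0 ^+ 2 / D r0 r0 = D y y.
  clearbody t y; rewrite zE !(DDl, DDr, DZl, DZr) (Dsym r0 y) yr.
  by field; rewrite gt_eqF.
rewrite Ly Dy; have Dyy := D_gt0 yN0.
case: Hk => [[l1 kl l1P]|k0].
  have [mu mu0 [muP [v vN0 vE]]] := rayleigh_min yN0 yr.
  rewrite subr_gt0; apply: lt_le_trans (muP _ yr).
  by rewrite ltr_pM2r//; apply: (lt_le_trans kl); exact: l1P vE.
have Ly0 : 0 < L y y.
  rewrite lt0r Lge0 andbT; apply/eqP => /Ldef[u yE]; apply: (zN (u + t)).
  by rewrite {1}zE yE scalerDl.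
rewrite subr_gt0; apply: le_lt_trans Ly0.
by rewrite mulr_le0_ge0// ltW.
Qed.

Lemma linearized_form_ge0 kappa z :
  (forall z, (forall t, z <> t *: r0) -> 0 < linearized_form kappa z) ->
  0 <= linearized_form kappa z.
Proof.
move=> h; have [[t zE]|zN] := pselect (exists t, z = t *: r0); last first.
  by apply/ltW/h => t zE; apply: zN; exists t.
rewrite zE /linearized_form -/L -/D bilZl bilZr Lker !mulr0 !DZl DZr.
have D00 : D r0 r0 != 0 by rewrite gt_eqF// D_gt0.
by rewrite (_ : _ - _ = 0)//; field.
Qed.

(** The form degenerates exactly on the line of [r0], where the added square is positive. In the
    application [m] is the gradient of the flow invariant. *)
Lemma linearized_form_coercive kappa (m : 'rV[R]_n) : dotv m r0 != 0 ->
  (forall z, (forall t, z <> t *: r0) -> 0 < linearized_form kappa z) ->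
  exists2 k, 0 < k &
    forall z, k * `|z| ^+ 2 <= linearized_form kappa z + dotv m z ^+ 2.
Proof.
move=> mr h; apply: quad_coercive.
- move=> z; have [g dL] := bil_sdiff z; have [g' dD] := D_sdiff z.
  have d0 := sdiffM (sdiffM (D0_sdiff z) (D0_sdiff z)) (sdiff_cst (D r0 r0)^-1 z).
  have dm := sdiffM (sdiff_dotv m z) (sdiff_dotv m z).
  exact: sdiff_continuous (sdiffD (sdiffB dL (sdiffZ kappa (sdiffB dD d0))) dm).
- move=> t z; rewrite /linearized_form dotvZr bilZl bilZr !DZl DZr.
  have D00 : D r0 r0 != 0 by rewrite gt_eqF// D_gt0.
  by field.
- move=> z zN0; have [[t zE]|zN] := pselect (exists t, z = t *: r0).
    rewrite ltr_wpDl ?linearized_form_ge0// lt0r sqr_ge0 andbT sqrf_eq0 zE dotvZr.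
    rewrite mulf_neq0//; apply: contra zN0 => /eqP t0.
    by rewrite zE t0 scale0r.
  rewrite ltr_pwDl ?sqr_ge0//; apply: h => t zE; apply: zN; by exists t.
Qed.

End QuadraticForms.

(** * Ordinary differential equations *)

Section RealCurves.
Variable R : realType.
Implicit Types (f g phi : R -> R) (a b t : R).

Lemma derive_le0_le f df a b : a <= b -> {within `[a, b], continuous f} ->
  (forall t, a < t < b -> is_derive t 1 f (df t)) ->
  (forall t, a < t < b -> df t <= 0) -> f b <= f a.
Proof.
move=> ab fC fd df0; have [aeb|anb] := eqVneq a b; first by rewrite aeb.
have ltab : a < b by rewrite lt_neqAle anb.
have [t tab fE] : exists2 t, t \in `]a, b[%R & f b - f a = df t * (b - a).
  by apply: MVT => // t; rewrite in_itv; exact: fd.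
rewrite -subr_le0 fE mulr_le0_ge0 ?subr_ge0//.
by apply: df0; move: tab; rewrite in_itv.
Qed.

Lemma derive_norm_le f df phi dphi a b : a <= b ->
  {within `[a, b], continuous f} -> {within `[a, b], continuous phi} ->
  (forall t, a < t < b -> is_derive t 1 f (df t)) ->
  (forall t, a < t < b -> is_derive t 1 phi (dphi t)) ->
  (forall t, a < t < b -> `|df t| <= dphi t) ->
  `|f b - f a| <= phi b - phi a.
Proof.
move=> ab fC pC fd pd dfp; rewrite ler_norml; apply/andP; split.
  rewrite -subr_le0.
  suff : (- f - phi) b <= (- f - phi) a by rewrite !fctE; lra.
  apply: (@derive_le0_le _ (fun t => - df t - dphi t)) => //.
  - by apply: within_continuousB => // x; apply: continuousN; exact: fC.
  - move=> t tab; have ? := fd t tab; have ? := pd t tab; exact: is_deriveB.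
  - by move=> t /dfp; rewrite ler_norml => /andP[? ?]; lra.
suff : (f - phi) b <= (f - phi) a by rewrite !fctE; lra.
apply: (@derive_le0_le _ (fun t => df t - dphi t)) => //.
- exact: within_continuousB.
- move=> t tab; have ? := fd t tab; have ? := pd t tab; exact: is_deriveB.
- by move=> t /dfp; rewrite ler_norml => /andP[? ?]; lra.
Qed.

Lemma antiderivative g : continuous g ->
  exists G : R -> R, G 0 = 0 /\ forall t, -1 < t -> is_derive t 1 G (g t).
Proof.
move=> gC.
(* Integrating from -1 makes 0 an interior point, so the derivative is two-sided there too. *)
pose F x := \int[lebesgue_measure]_(t in `[(-1), x]) g t.
exists (fun t => F t - F 0); split; first by rewrite subrr.
move=> t t1.
have gi : lebesgue_measure.-integrable `[(-1), t + 1] (EFin \o g).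
  apply: continuous_compact_integrable; first exact: segment_compact.
  exact: continuous_subspaceT.
have tt1 : t < t + 1 by rewrite ltrDl.
have [dF F'] := continuous_FTC1_closed tt1 gi t1 (gC t).
have dFt : is_derive t 1 F (g t) by apply: DeriveDef => //; rewrite -derive1E.
have := is_deriveB dFt (is_derive_cst (F 0) t 1).
by rewrite subr0; apply: near_eq_is_derive; near=> u.
Unshelve. all: by end_near. Qed.

(** Continuity method. If the level [rho] is reached, compactness provides a first time; up to that
    time the weak bound holds, and the hypothesis makes it strict, a contradiction. *)
Lemma first_exit phi rho T : continuous phi -> phi 0 < rho ->
  (forall t, 0 <= t <= T -> (forall s, 0 <= s <= t -> phi s <= rho) -> phi t < rho) ->
  forall t, 0 <= t <= T -> phi t < rho.
Proof.
move=> pC p0 h t1 /andP[t10 t1T]; rewrite ltNge; apply/negP => pt1.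
have [|s0 s0I ps0] := @IVT R phi 0 t1 rho t10 (continuous_subspaceT pC).
  by rewrite ge_min le_max (ltW p0) pt1 orbT.
pose S := `[0, t1] `&` phi @^-1` [set rho].
have Scpt : compact S.
  apply: compact_closedI; first exact: segment_compact.
  by apply: preimage_closed; [move=> x _; exact: pC|exact: closed_eq].
have [|t0 /set_mem[/= t0I pt0] t0min] := compact_EVT_min (ex_intro _ s0 (conj s0I
  ps0)) Scpt (f := id).
  by apply: continuous_subspaceT => x.
move: t0I; rewrite in_itv/= => /andP[t00 t0t1].
have : phi t0 < rho.
  apply: h; first by rewrite t00 (le_trans t0t1).
  move=> s /andP[s00 st0]; rewrite leNgt; apply/negP => ps.
  have [|u uI pu] := @IVT R phi 0 s rho s00 (continuous_subspaceT pC).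
    by rewrite ge_min le_max (ltW p0) (ltW ps) orbT.
  move: uI; rewrite in_itv/= => /andP[u0 us].
  have : t0 <= u.
    by apply: t0min; rewrite inE; split => //=;
      rewrite in_itv/= u0 (le_trans us)// (le_trans st0).
  move=> t0u; have se : s = t0 by lra.
  by move: ps; rewrite se pt0 ltxx.
by rewrite pt0 ltxx.
Qed.

Lemma le_geom (x y C : R) : (forall k, x <= y + C / 2 ^+ k) -> x <= y.
Proof.
move=> h; rewrite leNgt; apply/negP => yx.
pose k := Num.bound (`|C| / (x - y)).
have := h k; have xy0 : 0 < x - y by rewrite subr_gt0.
have : `|C| / (x - y) < 2 ^+ k by exact: upper_nthrootP.
rewrite ltr_pdivrMr// => hC hk.
have : C / 2 ^+ k < x - y.
  by rewrite ltr_pdivrMr ?exprn_gt0// mulrC; apply: le_lt_trans (ler_norm _) hC.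
lra.
Qed.

Lemma nested_intervals (a b : nat -> R) : (forall k m, a k <= b m) ->
  exists l, forall k, a k <= l <= b k.
Proof.
move=> ab; exists (sup (range a)) => k; apply/andP; split.
  by apply: ub_le_sup; [exists (b 0%N) => _ [m _ <-]|exists k].
by apply: ge_sup => [|_ [m _ <-]]; [exists (a 0%N), 0%N|].
Qed.

End RealCurves.

Lemma maxr_lipschitz (R : realType) (u v w : R) :
  `|Num.max w u - Num.max w v| <= `|u - v|.
Proof.
have h1 := ler_norm (u - v); have h2 := ler_norm (v - u); rewrite distrC in h2.
by case: (leP w u) => ?; case: (leP w v) => ?; rewrite ler_norml; apply/andP; split; lra.
Qed.

Lemma minr_lipschitz (R : realType) (u v w : R) :
  `|Num.min w u - Num.min w v| <= `|u - v|.
Proof.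
have h1 := ler_norm (u - v); have h2 := ler_norm (v - u); rewrite distrC in h2.
by case: (leP w u) => ?; case: (leP w v) => ?; rewrite ler_norml; apply/andP; split; lra.
Qed.

(** * Picard iteration for a bounded, globally Lipschitz field *)

Section Picard.
Variables (R : realType) (n : nat) (G : 'rV[R]_n -> 'rV[R]_n) (L M : R).
Hypothesis L_gt0 : 0 < L.
Hypothesis M_ge0 : 0 <= M.
Hypothesis Glip : forall x y, `|G x - G y| <= L * `|x - y|.
Hypothesis Gbound : forall x, `|G x| <= M.
Variable x0 : 'rV[R]_n.
Implicit Types (Y Z : R -> 'rV[R]_n).

Let lip Y := forall s t, `|Y s - Y t| <= M * `|s - t|.

Lemma lip_continuous (k : R) (f : R -> R) :
  (forall s t, `|f s - f t| <= k * `|s - t|) -> continuous f.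
Proof.
move=> h t; apply/cvgrPdist_le => /= e e0.
have k0 : 0 < `|k| + 1 by rewrite ltr_wpDl.
near=> s.
apply: (le_trans (h _ _)).
apply: (@le_trans _ _ ((`|k| + 1) * `|t - s|)).
  by rewrite ler_wpM2r// (le_trans (ler_norm _))// lerDl.
rewrite mulrC -ler_pdivlMr// ltW//; near: s.
by apply: (@cvgr_dist_lt _ _ _ (nbhs t)) => //; rewrite divr_gt0.
Unshelve. all: by end_near. Qed.

Lemma lip_coord_continuous Y i : lip Y -> continuous (fun t => Y t 0 i).
Proof.
move=> Yl; apply: (@lip_continuous M) => s t.
by apply: le_trans (Yl s t); have := coord_le_norm (Y s - Y t) i; rewrite !mxE.
Qed.

Lemma lip_field_continuous Y i : lip Y -> continuous (fun t => G (Y t) 0 i).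
Proof.
move=> Yl; apply: (@lip_continuous (L * M)) => s t.
have := coord_le_norm (G (Y s) - G (Y t)) i; rewrite !mxE => /le_trans; apply.
by rewrite (le_trans (Glip _ _))// -mulrA ler_pM2l.
Qed.

Let step Y Z := [/\ lip Z, Z 0 = x0 & forall (t : R) i, 0 < t ->
  is_derive t 1 (fun u => Z u 0 i) (G (Y t) 0 i)].

Lemma picard_step Y : lip Y -> exists Z, step Y Z.
Proof.
move=> Yl.
have /choice[A AP] : forall i, exists A : R -> R,
    A 0 = 0 /\ forall t : R, -1 < t -> is_derive t 1 A (G (Y t) 0 i).
  by move=> i; apply: antiderivative; exact: lip_field_continuous.
(* Negative times are sent to 0, so that the iterate is Lipschitz on all of R while the equation
   holds for t > 0. *)
pose p (t : R) := Num.max t 0.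
exists (fun t => \row_i (x0 0 i + A i (p t))).
have p0 t : 0 <= p t by rewrite le_max lexx orbT.
have AC i a b : 0 <= a -> {within `[a, b], continuous (A i)}.
  move=> a0; apply: derivable_within_continuous => t; rewrite in_itv/= => /andP[at_ _].
  have [_ /(_ t)] := AP i; case => //.
  by rewrite (lt_le_trans (_ : -1 < 0)) ?(le_trans a0)// ltrN10.
have Alip i s t : 0 <= s -> s <= t -> `|A i t - A i s| <= M * (t - s).
  move=> s0 st.
  have := @derive_norm_le R (A i) (fun t => G (Y t) 0 i) (fun t =>
    M * t) (fun=> M) s t st.
  rewrite -mulrBr; apply.
  - exact: AC.
  - by apply: continuous_subspaceT; exact: mulrl_continuous.
  - move=> u /andP[su ut]; have [_] := AP i; apply.
    by rewrite (lt_trans (_ : -1 < 0)) ?(le_lt_trans s0)// ltrN10.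
  - move=> u _; apply: is_derive_eq.
    by rewrite -![_ *: _]/(_ * _); ring.
  - by move=> u _; rewrite (le_trans (coord_le_norm _ _)).
split.
- move=> s t; apply: norm_le_coord; first by rewrite mulr_ge0.
  move=> i; rewrite !mxE opprD addrACA subrr add0r.
  have pl : `|p s - p t| <= `|s - t|.
    by rewrite /p !(maxC _ 0); exact: maxr_lipschitz.
  apply: (@le_trans _ _ (M * `|p s - p t|)); last by rewrite ler_wpM2l.
  case: (leP (p s) (p t)) => st.
    by rewrite distrC (distrC (p s)) (ger0_norm (_ : 0 <= p t - p s)) ?subr_ge0// Alip.
  rewrite (gtr0_norm (_ : 0 < p s - p t)) ?subr_gt0//.
  by apply: Alip => //; exact: ltW.
- apply/rowP => i; rewrite mxE /p maxxx.
  by have [-> _] := AP i; rewrite addr0.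
- move=> t i t0; have [_ /(_ t)] := AP i.
  rewrite (lt_trans (_ : -1 < 0)) ?ltrN10// => /(_ isT) dA.
  have := is_deriveD (is_derive_cst (x0 0 i) t 1) dA.
  rewrite add0r; apply: near_eq_is_derive.
  have : \forall u \near t, 0 < u by exact: lt_nbhsr.
  apply: filterS => u u0; rewrite mxE /p max_l// ltW//.
Qed.

(** Bielecki's weight: integrating [L * (C * E)] gives [C / 2 * E] up to a constant, so one Picard
    step halves weighted distances on the whole half-line and no gluing of short intervals is
    required. *)
Let E (t : R) := expR (2 * L * t).

Let dE (C t : R) : is_derive t 1 (fun t => C / 2 * E t) (L * (C * E t)).
Proof.
apply: is_derive_eq.
by rewrite -![_ *: _]/(_ * _) /E; field.
Qed.

Lemma picard_contract Y Y' Z Z' C : step Y Z -> step Y' Z' ->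
  (forall t, 0 <= t -> `|Y t - Y' t| <= C * E t) ->
  forall t, 0 <= t -> `|Z t - Z' t| <= C / 2 * E t.
Proof.
move=> [Zl Z0 Zd] [Z'l Z'0 Z'd] YY' t t0.
have C0 : 0 <= C.
  have := YY' 0 (lexx _); rewrite /E mulr0 expR0 mulr1; exact: le_trans.
apply: norm_le_coord; first by rewrite mulr_ge0 ?divr_ge0 ?expR_ge0.
move=> i; rewrite !mxE.
have := @derive_norm_le R (fun u => Z u 0 i - Z' u 0 i) (fun u =>
  G (Y u) 0 i - G (Y' u) 0 i)
  (fun u => C / 2 * E u) (fun u => L * (C * E u)) 0 t t0.
rewrite Z0 Z'0 subrr subr0 => h; apply: le_trans (h _ _ _ _ _) _.
- apply: continuous_subspaceT => u; apply: continuousB; exact: lip_coord_continuous.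
- apply: derivable_within_continuous => u _; by case: (dE C u).
- by move=> u /andP[u0 _]; apply: is_deriveB; [exact: Zd|exact: Z'd].
- by move=> u _; exact: dE.
- move=> u /andP[u0 _].
  have := coord_le_norm (G (Y u) - G (Y' u)) i; rewrite !mxE => /le_trans; apply.
  by rewrite (le_trans (Glip _ _))// ler_pM2l// YY'// ltW.
by rewrite gerBl mulr_ge0 ?divr_ge0 ?expR_ge0.
Qed.

Lemma picard_global : exists Z, step Z Z.
Proof.
have /choice[P PP] : forall Y, exists Z, lip Y -> step Y Z.
  move=> Y; have [Yl|nYl] := pselect (lip Y); last by exists Y.
  by have [Z HZ] := picard_step Yl; exists Z.
pose Y k := iter k P (fun=> x0).
have Yl k : lip (Y k).
  elim: k => [|k ih]; last by have [] := PP _ ih.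
  by move=> s t; rewrite subrr normr0 mulr_ge0.
have Ys k : step (Y k) (Y k.+1) by exact: PP.
(* Bounds the first step: M t = C (2 L t), and 2 L t is at most [E t]. *)
pose C := M / (2 * L).
have C0 : 0 <= C by rewrite divr_ge0 // mulr_ge0// ltW.
have Yk k t : 0 <= t -> `|Y k.+1 t - Y k t| <= C / 2 ^+ k * E t.
  elim: k t => [t t0|k ih t t0]; last first.
    have := @picard_contract _ _ _ _ (C / 2 ^+ k) (Ys k.+1) (Ys k) ih t t0.
    rewrite (_ : C / 2 ^+ k.+1 = C / 2 ^+ k / 2)//.
    by rewrite exprS; field; rewrite expf_neq0.
  have [Zl Z0 _] := Ys 0%N; have := Zl t 0; rewrite Z0 subr0 (ger0_norm t0) => h.
  rewrite (_ : Y 0%N t = x0)// expr0 divr1; apply: (le_trans h).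
  have -> : M * t = C * (2 * L * t) by rewrite /C; field; rewrite gt_eqF.
  rewrite ler_wpM2l//; have := expR_ge1Dx (2 * L * t); rewrite -/(E t); lra.
clearbody C.
have Ykm k m t : 0 <= t -> `|Y (k + m)%N t - Y k t| <= 2 * C / 2 ^+ k * E t.
  move=> t0.
  have : `|Y (k + m)%N t - Y k t| <= 2 * C * (1 - (2 ^+ m)^-1) / 2 ^+ k * E t.
    elim: m => [|m ih].
      by rewrite addn0 subrr normr0 expr0 invr1 subrr mulr0 !mul0r.
    rewrite addnS -[Y _.+1 t](subrK (Y (k + m)%N t)) -addrA.
    apply: (le_trans (ler_normD _ _)).
    apply: (le_trans (lerD (Yk _ _ t0) ih)).
    rewrite -mulrDl ler_pM2r ?expR_gt0// exprD exprS le_eqVlt; apply/orP; left; apply/eqP.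
    by field; rewrite !expf_neq0.
  move/le_trans; apply; rewrite ler_pM2r ?expR_gt0// ler_pM2r ?invr_gt0 ?exprn_gt0//.
  by apply: ler_piMr; rewrite ?mulr_ge0// lerBlDr lerDl invr_ge0 exprn_ge0.
(* Tail from index k on of the geometric series that bounds the successive differences. *)
pose B k t := 2 * C / 2 ^+ k * E t.
have lims t i : exists l, 0 <= t -> forall k, `|Y k t 0 i - l| <= B k t.
  have [t0|t0] := leP 0 t; last by exists 0.
  have cm k m : `|Y (k + m)%N t 0 i - Y k t 0 i| <= B k t.
    by have := coord_le_norm (Y (k + m)%N t - Y k t) i; rewrite !mxE => /le_trans;
      apply; exact: Ykm.
  have B0 k : 0 <= B k t by rewrite mulr_ge0 ?expR_ge0// divr_ge0 ?mulr_ge0 ?exprn_ge0.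
  have [|l hl] := @nested_intervals R (fun k => Y k t 0 i - B k t) (fun k =>
    Y k t 0 i + B k t).
    move=> k m; case: (leqP k m) => km.
      have := cm k (m - k)%N; rewrite subnKC// ler_distl => /andP[+ _].
      by move=> h; apply: (le_trans h); rewrite lerDl.
    have := cm m (k - m)%N; rewrite subnKC 1?ltnW// ler_distl => /andP[_ +].
    by move=> h; rewrite lerBlDr; apply: (le_trans h); rewrite lerDl.
  by exists l => _ k; have /andP[? ?] := hl k; rewrite ler_distl; apply/andP; lra.
have /choice[l lP] : forall t, exists l : 'I_n -> R, forall i, 0 <=
  t -> forall k, `|Y k t 0 i - l i| <= B k t.
  by move=> t; have /choice[l hl] := lims t; exists l.
pose p (t : R) := Num.max t 0.
have p0 t : 0 <= p t by rewrite le_max lexx orbT.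
have pE t : 0 <= t -> p t = t by move=> t0; rewrite /p max_l.
pose W t := \row_i l (p t) i.
have WP t k : 0 <= t -> `|Y k t - W t| <= B k t.
  move=> t0; apply: norm_le_coord.
    by rewrite mulr_ge0 ?expR_ge0// divr_ge0 ?mulr_ge0 ?exprn_ge0.
  by move=> i; rewrite !mxE pE// lP.
have pl s t : `|p s - p t| <= `|s - t|.
  by rewrite /p !(maxC _ 0); exact: maxr_lipschitz.
have Wp t : W t = W (p t) by rewrite /W (pE (p t)).
have Wl : lip W.
  move=> s t; apply: (@le_trans _ _ (M * `|p s - p t|)); last by rewrite ler_wpM2l.
  rewrite (Wp s) (Wp t).
  apply: (@le_geom _ _ _ (2 * C * E (p s) + 2 * C * E (p t))) => k.
  have -> : W (p s) - W (p t) = (Y k (p s) - Y k (p t)) +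
    ((- (Y k (p s) - W (p s))) + (Y k (p t) - W (p t))).
    by apply/rowP => i; rewrite !mxE; ring.
  apply: (le_trans (ler_normD _ _)); apply: lerD; first exact: Yl.
  apply: (le_trans (ler_normD _ _)); rewrite normrN.
  apply: (le_trans (lerD (WP _ _ (p0 s)) (WP _ _ (p0 t)))).
  by rewrite /B le_eqVlt; apply/orP; left; apply/eqP; ring.
(* [W] is a pointwise limit with no known derivative. One further Picard step [Z] has one, and it
   agrees with [W] for t >= 0 because both are geometrically close to the iterates. *)
have [Z Zs] := picard_step Wl.
have WZ t : 0 <= t -> W t = Z t.
  move=> t0; apply/eqP; rewrite -subr_eq0 -normr_le0.
  apply: (@le_geom _ _ _ (2 * C * E t)) => k; rewrite add0r.
  have -> : W t - Z t = (- (Y k.+1 t - W t)) + (Y k.+1 t - Z t).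
    by apply/rowP => i; rewrite !mxE; ring.
  apply: (le_trans (ler_normD _ _)); rewrite normrN.
  have h1 : `|Y k.+1 t - Z t| <= 2 * C / 2 ^+ k / 2 * E t.
    by apply: (picard_contract (Ys k) Zs) => // u u0; exact: WP.
  apply: (le_trans (lerD (WP _ k.+1 t0) h1)).
  rewrite /B exprS le_eqVlt; apply/orP; left; apply/eqP.
  by field; rewrite expf_neq0.
exists Z; case: Zs => Zl Z0 Zd; split=> // t i t0.
by have := Zd t i t0; rewrite WZ// ltW.
Qed.

End Picard.

Lemma clamp_lipschitz (R : realType) (lo hi x y : R) :
  `|Num.max lo (Num.min hi x) - Num.max lo (Num.min hi y)| <= `|x - y|.
Proof.
exact: le_trans (maxr_lipschitz _ _ _) (minr_lipschitz _ _ _).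
Qed.

(** * Weighted square distance and Gronwall's inequality *)

Section Energy.
Variables (R : realType) (n : nat).
Implicit Types (Y Z : R -> 'rV[R]_n) (x y e : 'rV[R]_n) (m : 'I_n -> R).

Definition energy m e x : R := \sum_i m i * (x 0 i - e 0 i) ^+ 2.

Lemma energy_norm m e x (a b : R) : 0 < a -> 0 <= b -> (forall i, a <= m i) ->
  energy m e x <= a * b ^+ 2 -> `|x - e| <= b.
Proof.
move=> a0 b0 am h; apply: norm_le_coord => // i; rewrite !mxE.
have : a * (x 0 i - e 0 i) ^+ 2 <= a * b ^+ 2.
  apply: le_trans h; apply: (@le_trans _ _ (m i * (x 0 i - e 0 i) ^+ 2)).
    by rewrite ler_wpM2r ?sqr_ge0.
  rewrite /energy (bigD1 i)//= lerDl sumr_ge0// => j _.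
  by rewrite mulr_ge0 ?sqr_ge0// (le_trans (ltW a0)).
by rewrite ler_pM2l// -(real_normK (num_real (x 0 i - e 0 i))) ler_sqr ?nnegrE.
Qed.

Lemma energy_ge0 m e x : (forall i, 0 <= m i) -> 0 <= energy m e x.
Proof. by move=> m0; rewrite sumr_ge0// => i _; rewrite mulr_ge0 ?sqr_ge0. Qed.

Lemma is_derive_bigsum (f : 'I_n -> R -> R) (df : 'I_n -> R) (t : R) :
  (forall i, is_derive t 1 (f i) (df i)) ->
  is_derive t 1 (fun u => \sum_i f i u) (\sum_i df i).
Proof.
move=> fd; have -> : (fun u => \sum_i f i u) = \sum_i f i.
  by apply/funext => u; rewrite fct_sumE.
exact: is_derive_sum.
Qed.

Lemma is_derive_energy m Y Z (dY dZ : 'rV[R]_n) (t : R) :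
  (forall i, is_derive t 1 (fun u => Y u 0 i) (dY 0 i)) ->
  (forall i, is_derive t 1 (fun u => Z u 0 i) (dZ 0 i)) ->
  is_derive t 1 (fun u => energy m (Z u) (Y u))
    (2 * \sum_i m i * (Y t 0 i - Z t 0 i) * (dY 0 i - dZ 0 i)).
Proof.
move=> dYP dZP; rewrite mulr_sumr; apply: is_derive_bigsum => i.
have dYi := dYP i; have dZi := dZP i.
have dd := is_deriveB dYi dZi.
have := is_deriveZ (m i) (is_deriveX 2 dd).
rewrite -![_ *: _]/(_ * _) expr1.
set l := (X in is_derive _ _ _ X -> _); have -> : l =
  2 * (m i * (Y t 0 i - Z t 0 i) * (dY 0 i - dZ 0 i)).
  by rewrite /l -[(_ - _) t]/(Y t 0 i - Z t 0 i); ring.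
by apply: near_eq_is_derive; near=> u.
Unshelve. all: by end_near. Qed.

(** The integrating factor exp(- k s) makes the product nonincreasing. The sign of [k] is free:
    negative for decay towards an equilibrium, nonnegative for uniqueness. *)
Lemma gronwall (f df : R -> R) (k t : R) : 0 <= t ->
  {within `[0, t], continuous f} ->
  (forall s, 0 < s < t -> is_derive s 1 f (df s)) ->
  (forall s, 0 < s < t -> df s <= k * f s) -> f t <= f 0 * expR (k * t).
Proof.
move=> t0 fC fd dfk.
pose h s := expR (- (k * s)).
have hd (s : R) : is_derive s 1 h (- k * h s).
  by apply: is_derive_eq; rewrite -![_ *: _]/(_ * _) /h; ring.
have : (f \* h) t <= (f \* h) 0.
  apply: (@derive_le0_le _ _ (fun s => (df s - k * f s) * h s)) => //.
  - move=> s; apply: continuousM; first exact: fC.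
    apply: continuous_subspaceT => u.
    by case: (hd u) => /derivable1_diffP/differentiable_continuous.
  - move=> s st; have fds := fd s st; have hds := hd s.
    apply: (is_derive_eq (is_deriveM fds hds)).
    by rewrite -![_ *: _]/(_ * _); ring.
  - by move=> s /dfk ?; rewrite mulr_le0_ge0 ?expR_ge0// subr_le0.
rewrite /h /= mulr0 oppr0 expR0 mulr1 expRN => hh.
by rewrite -ler_pdivrMr ?expR_gt0.
Qed.

End Energy.

Lemma lip_continuous_rV (R : realType) (n : nat) (Z : R -> 'rV[R]_n) (M : R) :
  (forall s t, `|Z s - Z t| <= M * `|s - t|) -> continuous Z.
Proof.
move=> Zl.
move=> t A /nbhs_rVP[d d0 hd].
have M1 : 0 < `|M| + 1 by rewrite ltr_wpDl.
have : \forall u \near t, `|t - u| < d / (`|M| + 1).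
  by apply: (@cvgr_dist_lt _ _ _ (nbhs t)) => //; rewrite divr_gt0.
apply: filterS => u; rewrite ltr_pdivlMr// mulrC => hu; apply: hd.
apply: le_lt_trans hu; rewrite distrC; apply: (le_trans (Zl _ _)).
by rewrite ler_wpM2r// (le_trans (ler_norm _))// lerDl.
Qed.

Lemma energy_le (R : realType) (n : nat) (m : 'I_n -> R) (e x : 'rV[R]_n) :
  (forall i, 0 <= m i) -> energy m e x <= (\sum_i m i) * `|x - e| ^+ 2.
Proof.
move=> m0; rewrite mulr_suml; apply: ler_sum => i _; rewrite ler_wpM2l//.
rewrite -(real_normK (num_real (x 0 i - e 0 i))) ler_sqr ?nnegrE//.
by have := coord_le_norm (x - e) i; rewrite !mxE.
Qed.

(** * Existence, convergence and uniqueness near a point *)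

Section LocalFlow.
Variables (R : realType) (n : nat) (F : 'rV[R]_n -> 'rV[R]_n).
Variables (p : 'rV[R]_n) (rho L : R).
Hypothesis rho_gt0 : 0 < rho.
Hypothesis L_gt0 : 0 < L.
Hypothesis Flip : forall x y, `|x - p| <= rho -> `|y - p| <= rho ->
  `|F x - F y| <= L * `|x - y|.

Let solves (t : R) (Z : R -> 'rV[R]_n) :=
  forall i, is_derive t 1 (fun u => Z u 0 i) (F (Z t) 0 i).

(* The vector field is made globally Lipschitz by precomposing it with the
   projection onto the cube of side 2 rho around p. *)
Lemma clamped_flow x0 : exists Z, exists2 M,
  (forall s t : R, `|Z s - Z t| <= M * `|s - t|) &
  Z 0 = x0 /\ (forall t : R, 0 < t -> `|Z t - p| <= rho -> solves t Z).
Proof.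
pose c (x : 'rV[R]_n) : 'rV[R]_n :=
  \row_i Num.max (p 0 i - rho) (Num.min (p 0 i + rho) (x 0 i)).
have cp x : `|c x - p| <= rho.
  apply: norm_le_coord; first exact: ltW.
  move=> i; rewrite !mxE ler_distl; apply/andP; split.
    by rewrite le_max lexx.
  by rewrite ge_max ge_min lexx/= andbT; have := rho_gt0; lra.
have cl x y : `|c x - c y| <= `|x - y|.
  apply: norm_le_coord => // i; rewrite !mxE.
  have := coord_le_norm (x - y) i; rewrite !mxE => /(le_trans _); apply.
  exact: clamp_lipschitz.
have cE x : `|x - p| <= rho -> c x = x.
  move=> xp; apply/rowP => i; rewrite mxE.
  have := le_trans (coord_le_norm (x - p) i) xp; rewrite !mxE ler_distl => /andP[h1 h2].
  by rewrite min_r// max_r.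
pose M := `|F p| + L * rho.
have M0 : 0 <= M by rewrite addr_ge0// mulr_ge0// ltW.
have pp : `|p - p| <= rho by rewrite subrr normr0 ltW.
have [||Z [Zl Z0 Zd]] := @picard_global R n (F \o c) L M L_gt0 M0 _ _ x0.
- by move=> x y /=; rewrite (le_trans (Flip _ _))// ler_pM2l.
- move=> x /=; rewrite -[F _](subrK (F p)) addrC (le_trans (ler_normD _ _))//.
  by rewrite lerD2l (le_trans (Flip _ _))// ler_pM2l.
exists Z; exists M => //; split=> // t t0 Zp i.
by have := Zd t i t0; rewrite /= cE.
Qed.

Section Stability.
Variables (m : 'I_n -> R) (a kappa : R) (I : 'rV[R]_n -> R) (e x0 : 'rV[R]_n).
Hypothesis a_gt0 : 0 < a.
Hypothesis am : forall i, a <= m i.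
Hypothesis kappa_gt0 : 0 < kappa.
Hypothesis Icont : forall x, `|x - p| <= rho -> {for x, continuous I}.
Hypothesis Iflow : forall Z (t : R), `|Z t - p| <= rho -> solves t Z ->
  is_derive t 1 (I \o Z) 0.
Hypothesis Fdissip : forall x, `|x - p| <= rho -> I x = I e ->
  \sum_i m i * (x 0 i - e 0 i) * F x 0 i <= - kappa * energy m e x.
Hypothesis Ix0 : I x0 = I e.
Hypothesis ep : `|e - p| <= rho / 4.
Hypothesis x0_small : energy m e x0 <= a * (rho / 4) ^+ 2.

(** While the solution stays in the ball of radius [rho], the invariant keeps it on the level set of
    [e], so dissipation and Gronwall make the energy decay. This confines it to distance rho/4 from
    [e], hence rho/2 from [p], and [first_exit] closes the loop. *)
Lemma stable_flow : exists Z, exists2 M,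
  (forall s t : R, `|Z s - Z t| <= M * `|s - t|) &
  [/\ Z 0 = x0, forall t : R, 0 <= t -> `|Z t - p| <= rho / 2,
      forall t : R, 0 < t -> solves t Z & Z t @[t --> +oo] --> e].
Proof.
have [Z [M Zl [Z0 Zd]]] := clamped_flow x0; exists Z; exists M => //.
have Zi i : continuous (fun t => Z t 0 i).
  apply: (@lip_continuous R M) => s t.
  by apply: le_trans (Zl s t); have := coord_le_norm (Z s - Z t) i; rewrite !mxE.
have ZC := lip_continuous_rV Zl.
have m0 i : 0 <= m i by rewrite (le_trans (ltW a_gt0)).
have decay t : 0 <= t -> (forall s, 0 <= s <= t -> `|Z s - p| <= rho) ->
    energy m e (Z t) <= energy m e x0 * expR (- 2 * kappa * t).
  move=> t0 Zs.
  have IE s : 0 <= s <= t -> I (Z s) = I e.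
    move=> /andP[s0 st]; rewrite -Ix0 -Z0; apply/eqP; rewrite -subr_eq0 -normr_le0.
    have := @derive_norm_le R (I \o Z) (fun=> 0) (fun=> 0) (fun=> 0) 0 s s0;
      rewrite subrr; apply.
    - apply/continuous_in_subspaceT => u; rewrite inE/= in_itv/= => /andP[u0 us].
      apply: continuous_comp; first exact: ZC.
      by apply: Icont; apply: Zs; rewrite u0 (le_trans us).
    - by apply: continuous_subspaceT => u; exact: cvg_cst.
    - move=> u /andP[u0 us]; have Zu : `|Z u - p| <= rho by apply: Zs;
      rewrite ltW//= (le_trans (ltW us)).
      by apply: Iflow => //; exact: Zd.
    - by move=> u _; rewrite normr0.
  rewrite -Z0.
  apply: (@gronwall R (fun s => energy m e (Z s)) (fun s =>
    2 * \sum_i m i * (Z s 0 i - e 0 i) * (F (Z s) 0 i - (0 : 'rV[R]_n) 0 i))) => //.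
  - apply: continuous_subspaceT => u; apply: (@continuous_comp _ _ _ Z (energy m
    e)); first exact: ZC.
    have : exists g, sdiff (energy m e) (Z u) g.
      eexists; apply: sdiff_sum => i _; apply: sdiffZ.
      apply: (sdiff_comp (sdiff1_sqr _)); apply: sdiffB;
        [exact: sdiff_coord|exact: sdiff_cst].
    by case=> g; exact: sdiff_continuous.
  - move=> s /andP[s0 st]; apply: is_derive_energy => i.
      by apply: Zd => //; apply: Zs; rewrite !ltW.
    by rewrite mxE; exact: is_derive_cst.
  - move=> s /andP[s0 st].
    have sI : 0 <= s <= t by rewrite !ltW.
    under eq_bigr do rewrite mxE subr0.
    have := Fdissip (Zs _ sI) (IE _ sI); lra.
have decay_le t : 0 <= t -> expR (- 2 * kappa * t) <= 1.
  by move=> t0; rewrite -expR0 ler_expR !mulNr oppr_le0 !mulr_ge0// ltW.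
have near_e t : 0 <= t -> (forall s, 0 <= s <= t -> `|Z s - p| <=
  rho) -> `|Z t - p| <= rho / 2.
  move=> t0 /(decay _ t0) h.
  have : `|Z t - e| <= rho / 4.
    apply: (@energy_norm R n m e (Z t) a) => //; first by rewrite divr_ge0 ?ltW.
    apply: (le_trans h); apply: le_trans x0_small; rewrite ler_piMr ?decay_le//.
    exact: energy_ge0.
  have -> : Z t - p = (Z t - e) + (e - p) by rewrite addrA subrK.
  move=> h1; apply: (le_trans (ler_normD _ _)); move: ep h1; lra.
have Zin t : 0 <= t -> `|Z t - p| < rho.
  move=> t0.
  apply: (@first_exit R (fun t => `|Z t - p|) rho t).
  - move=> u; apply: (@continuous_comp _ _ _ (fun u =>
    Z u - p) (fun x : 'rV[R]_n => `|x|)); last exact: norm_continuous.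
    by apply: continuousB; [exact: ZC|exact: cvg_cst].
  - apply: (@le_lt_trans _ _ (rho / 2)); last by rewrite ltr_pdivrMr// mulr_natr
    mulr2n ltrDl.
    rewrite Z0; have -> : x0 - p = (x0 - e) + (e - p) by rewrite addrA subrK.
    have : `|x0 - e| <= rho / 4.
      by apply: (@energy_norm R n m e x0 a) => //; rewrite divr_ge0 ?ltW.
    by move=> h1; apply: (le_trans (ler_normD _ _)); move: ep h1; lra.
  - move=> u /andP[u0 _] h; apply: le_lt_trans (near_e _ u0 h) _.
    by rewrite ltr_pdivrMr// mulr_natr mulr2n ltrDl.
  - by rewrite t0 lexx.
have Zin' t : 0 <= t -> forall s, 0 <= s <= t -> `|Z s - p| <= rho.
  by move=> t0 s /andP[s0 _]; rewrite ltW// Zin.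
split=> //.
- by move=> t t0; apply: near_e => //; exact: Zin'.
- by move=> t t0; apply: Zd => //; rewrite ltW// Zin// ltW.
- move=> A /nbhs_rVP[d d0 hd].
  pose b := a * (d / 2) ^+ 2.
  have b0 : 0 < b by rewrite mulr_gt0// exprn_gt0// divr_gt0.
  have E0 : 0 <= energy m e x0 by exact: energy_ge0.
  (* Beyond this time b (1 + 2 kappa t) exceeds the initial energy, and exp(2 kappa t) >= 1 + 2
     kappa t then pushes the decayed energy below b. *)
  exists (energy m e x0 / (2 * kappa * b)); split; first exact: num_real.
  move=> t; rewrite ltr_pdivrMr ?mulr_gt0// => ht.
  have t0 : 0 <= t.
    rewrite leNgt; apply/negP => tn; move: ht; rewrite ltNge => /negP; apply.
    by apply: le_trans E0; rewrite mulr_le0_ge0 ?ltW// !mulr_gt0.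
  apply: hd; apply: (@le_lt_trans _ _ (d / 2));
    last by rewrite ltr_pdivrMr// mulr_natr mulr2n ltrDl.
  apply: (@energy_norm R n m e (Z t) a) => //; first by rewrite divr_ge0 ?ltW.
  apply: (le_trans (decay _ t0 (Zin' _ t0))); rewrite -/b.
  rewrite -[- 2 * kappa * t]opprK expRN ler_pdivrMr ?expR_gt0//.
  have := expR_ge1Dx (- (- 2 * kappa * t)) => h.
  apply: (@le_trans _ _ (b * (1 + - (- 2 * kappa * t)))); last by rewrite ler_pM2l.
  by move: ht; nra.
Qed.

End Stability.

(** Nothing confines [r] to the Lipschitz ball beforehand. As long as its distance to [Z] is at most
    rho/2 it stays there, and Gronwall from 0 makes that distance vanish; [first_exit] turns this
    into a bound for all times. *)
Lemma flow_unique (Z : R -> 'rV[R]_n) (M : R) (b : \bar R) (r : R -> 'rV[R]_n) :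
  (forall s t : R, `|Z s - Z t| <= M * `|s - t|) ->
  (forall t : R, 0 <= t -> `|Z t - p| <= rho / 2) ->
  (forall t : R, 0 < t -> solves t Z) -> r 0 = Z 0 ->
  {within [set t : R | 0 <= t /\ (t%:E < b)%E], continuous r} ->
  (forall t : R, 0 < t -> (t%:E < b)%E -> solves t r) ->
  forall t : R, 0 <= t -> (t%:E < b)%E -> r t = Z t.
Proof.
move=> Zl Zp Zd r0 rC rd t1 t10 t1b.
have Zi i : continuous (fun t => Z t 0 i).
  apply: (@lip_continuous R M) => s t.
  by apply: le_trans (Zl s t); have := coord_le_norm (Z s - Z t) i; rewrite !mxE.
(* Clamping time to [0, t1] makes [r \o c] continuous on all of R, although [r] is so only within
   its interval of existence. *)
pose c (u : R) := Num.max 0 (Num.min u t1).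
have cA u : 0 <= c u /\ ((c u)%:E < b)%E.
  split; first by rewrite le_max lexx.
  by apply: le_lt_trans t1b; rewrite lee_fin ge_max t10 ge_min lexx orbT.
have cE u : 0 <= u <= t1 -> c u = u.
  by move=> /andP[u0 ut]; rewrite /c min_l// max_r.
have cC : continuous c.
  apply: (@lip_continuous R 1) => u v; rewrite mul1r /c.
  by rewrite !(minC _ t1); exact: clamp_lipschitz.
have rcC : continuous (r \o c).
  move=> u A Ar.
  have /subspace_continuousP/(_ (c u) (cA u))/(_ A Ar) h := rC.
  have h' : nbhs (c u) [set v : R | 0 <= v /\ (v%:E < b)%E -> A (r v)] by exact: h.
  have h2 : nbhs u [set v | 0 <= c v /\ ((c v)%:E < b)%E -> A (r (c v))] by exact:
    (cC u _ h').
  suff : nbhs u [set v | A (r (c v))] by [].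
  by apply: filterS h2 => v /= hv; apply: hv; exact: cA.
have rci i : continuous (fun u => r (c u) 0 i).
  move=> u; apply: (@continuous_comp _ _ _ (r \o c) (fun x : 'rV[R]_n => x 0 i));
    first exact: rcC.
  exact: coord_continuous.
pose phi u := energy (fun=> 1) (Z u) (r (c u)).
have phiC : continuous phi.
  have : forall s : seq 'I_n, continuous (fun u =>
    \sum_(i <- s) (1 * (r (c u) 0 i - Z u 0 i) ^+ 2)).
    elim=> [|i s ih] u.
      rewrite (_ : (fun u => _) = cst 0); first exact: cvg_cst.
      by apply/funext => v; rewrite big_nil.
    rewrite (_ : (fun u => _) = (fun u => 1 * (r (c u) 0 i - Z u 0 i) ^+ 2 +
      \sum_(i <- s) (1 * (r (c u) 0 i - Z u 0 i) ^+ 2))); last first.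
      by apply/funext => v; rewrite big_cons.
    apply: cvgD; last exact: ih.
    apply: cvgM; first exact: cvg_cst.
    apply: (@cvg_comp _ _ _ (fun u => r (c u) 0 i - Z u 0 i) (fun x : R =>
      x ^+ 2)); last exact: exprn_continuous.
    by apply: cvgB; [exact: rci|exact: Zi].
  by apply.
have phi0 : phi 0 = 0.
  rewrite /phi cE ?lexx// r0 /energy big1// => i _.
  by rewrite subrr expr0n mulr0.
have phi_norm u e : 0 <= e -> phi u <= e ^+ 2 -> `|r (c u) - Z u| <= e.
  by move=> e0 h; apply: (@energy_norm R n (fun=> 1) _ _ 1) => //; rewrite mul1r.
have phi_small t : 0 <= t <= t1 ->
    (forall s, 0 <= s <= t -> phi s <= (rho / 2) ^+ 2) -> phi t <= 0.
  move=> /andP[t0 tt1] hs; rewrite -[0](mul0r (expR (2 * n%:R * L * t))) -phi0.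
  have rin s : 0 <= s <= t -> `|r (c s) - p| <= rho.
    move=> st; have h1 := phi_norm _ _ (ltW (divr_gt0 rho_gt0 (ltr0Sn _ 1))) (hs _ st).
    have -> : r (c s) - p = (r (c s) - Z s) + (Z s - p) by rewrite addrA subrK.
    apply: (le_trans (ler_normD _ _)); move: st => /andP[s0 _].
    by have := Zp s s0; lra.
  apply: (@gronwall R phi (fun s => 2 * \sum_i 1 * (r (c s) 0 i - Z s 0 i) * (F (r
    (c s)) 0 i - F (Z s) 0 i))) => //.
  - exact: continuous_subspaceT.
  - move=> s /andP[s0 st]; apply: (@is_derive_energy R n (fun=> 1) (r \o c) Z) =>
    i; last exact: Zd.
    have sI : 0 <= s <= t1 by rewrite ltW//= ltW// (lt_le_trans st).
    have sb : (s%:E < b)%E by have [_] := cA s; rewrite cE.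
    have := rd s s0 sb i; rewrite /= cE//; apply: near_eq_is_derive.
    near=> u; rewrite /= cE//; apply/andP; split.
      by apply: ltW; near: u; exact: lt_nbhsr.
    by apply: ltW; near: u; apply: lt_nbhsl; exact: (lt_le_trans st).
  - move=> s /andP[s0 st].
    have sI : 0 <= s <= t by rewrite !ltW.
    have hn := Flip (rin _ sI) (le_trans (Zp _ (ltW s0)) (_ : rho / 2 <= rho)).
    have hn' : `|F (r (c s)) - F (Z s)| <= L * `|r (c s) - Z s|.
      by apply: hn; have := rho_gt0; lra.
    rewrite -!mulrA ler_pM2l//.
    (* For the sup norm each of the n terms is at most L |r - Z|^2, and |r - Z|^2 is at most
       [phi s]; hence the rate 2 n L. *)
    apply: (@le_trans _ _ (\sum_(i < n) L * `|r (c s) - Z s| ^+ 2)).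
      apply: ler_sum => i _; rewrite mul1r (le_trans (ler_norm _))// normrM expr2 mulrCA.
      rewrite ler_pM//; first by have := coord_le_norm (r (c s) - Z s) i; rewrite !mxE.
      by have := coord_le_norm (F (r (c s)) - F (Z s)) i;
        rewrite !mxE => /le_trans; apply.
    rewrite sumr_const card_ord -[X in X <= _]mulr_natl ler_wpM2l ?ler0n// ler_pM2l//.
    have /(phi_norm s _ (sqrtr_ge0 _)) h2 : phi s <= Num.sqrt (phi s) ^+ 2.
      by rewrite sqr_sqrtr// energy_ge0// => i.
    rewrite -(@sqr_sqrtr _ (phi s)) ?energy_ge0//.
    by rewrite ler_sqr ?nnegrE ?sqrtr_ge0.
have phit t : 0 <= t <= t1 -> phi t < (rho / 2) ^+ 2.
  apply: first_exit => //; first by rewrite phi0 exprn_gt0// divr_gt0.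
  by move=> u uI h; apply: le_lt_trans (phi_small _ uI h) _; rewrite exprn_gt0// divr_gt0.
have h : phi t1 <= 0 ^+ 2.
  rewrite expr0n/=; apply: phi_small; first by rewrite t10 lexx.
  by move=> s st; rewrite ltW// phit.
have := phi_norm _ _ (lexx 0) h.
by rewrite cE ?t10 ?lexx// normr_le0 subr_eq0 => /eqP.
Unshelve. all: by end_near. Qed.

End LocalFlow.

(** * The linearized flow *)

Section PowR.
Variable R : realType.
Implicit Types x p q : R.

Lemma powRDp x p q : 0 < x -> x `^ (p + q) = x `^ p * x `^ q.
Proof. by move=> x0; rewrite powRD// (gt_eqF x0) implybT. Qed.

Lemma powRS x p : 0 < x -> x `^ (p + 1) = x `^ p * x.
Proof. by move=> x0; rewrite powRDp// powRr1// ltW. Qed.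

End PowR.

(** * Scale invariance of the curvature *)

Section Scaling.
Variables (R : realType) (N : nat) (T : {set {set 'I_N}}).
Implicit Types (r : 'rV[R]_N) (c : R).

Lemma edge_dot_scale r c i j k : edge_dot (c *: r) i j k = c ^+ 2 * edge_dot r i j k.
Proof. by rewrite /edge_dot /edge_length !mxE; case: ifP => _; ring. Qed.

Lemma edge_dot_perp_scale r c i j k l : c != 0 ->
  edge_dot_perp (c *: r) i j k l = c ^+ 2 * edge_dot_perp r i j k l.
Proof.
move=> c0; rewrite /edge_dot_perp !edge_dot_scale invfM.
rewrite mulrBr; congr (_ - _).
by move: (edge_dot r i j k) (edge_dot r i j l) (edge_dot r i j j)^-1 => a b d; field.
Qed.

Lemma dihedral_scale r c i j k l : 0 < c ->
  dihedral (c *: r) i j k l = dihedral r i j k l.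
Proof.
move=> c0; rewrite /dihedral !edge_dot_perp_scale ?gt_eqF//; congr acos.
have sq (u : R) : Num.sqrt (c ^+ 2 * u) = c * Num.sqrt u.
  by rewrite sqrtrM ?sqr_ge0// sqrtr_sqr gtr0_norm.
rewrite !sq !invfM.
move: (Num.sqrt (edge_dot_perp r i j k k))^-1 (Num.sqrt (edge_dot_perp r i j l
  l))^-1 => a b.
by field; rewrite gt_eqF.
Qed.

Lemma K_scale r c i : 0 < c -> K T (c *: r) i = K T r i.
Proof.
move=> c0; rewrite /K; congr (_ - _); apply: eq_bigr => s _.
rewrite /solid_angle_at; case: (enum _) => [//|j [//|k [//|l []//]]].
by rewrite /solid_angle !dihedral_scale.
Qed.

End Scaling.

(** * The flow field and its derivative at an equilibrium *)

Section FlowField.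
Variables (R : realType) (N : nat) (T : {set {set 'I_N}}) (alpha beta : R).
Implicit Types (r z : 'rV[R]_N).

Let V r := \sum_i r 0 i `^ (alpha + 1).

Lemma V_gt0 r (i0 : 'I_N) : (forall i, 0 < r 0 i) -> 0 < V r.
Proof.
move=> r0; rewrite /V (bigD1 i0)//= ltr_pwDl ?powR_gt0// sumr_ge0// => i _.
exact: powR_ge0.
Qed.

Lemma constant_curvatureE r : constant_curvature_metric T alpha r ->
  forall i, K T r i = s_alpha T alpha r * r 0 i `^ alpha.
Proof.
move=> [[r0 _] cc] i.
have KE j : K T r j = K T r i / r 0 i `^ alpha * r 0 j `^ alpha.
  by rewrite (cc i j) divfK// gt_eqF// powR_gt0.
rewrite [LHS]KE; congr (_ * _); rewrite /s_alpha -/(V r).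
have V0 := V_gt0 i r0.
rewrite -[LHS](mulfK (lt0r_neq0 V0)); congr (_ / _).
by rewrite /V mulr_sumr; apply: eq_bigr => j _; rewrite powRS// mulrA -KE.
Qed.

Section Equilibrium.
Variables (r0 : 'rV[R]_N) (i0 : 'I_N).
Hypothesis r0C : constant_curvature_metric T alpha r0.
Let r0_gt0 i : 0 < r0 0 i. Proof. by case: r0C => -[]. Qed.
Let s := s_alpha T alpha r0.

(** K has degree 0 and [s_alpha] degree - alpha under scaling, so the two terms of the field keep
    cancelling along the ray. *)
Lemma flow_field_equilibrium c i : 0 < c -> flow_field T alpha beta (c *: r0) i = 0.
Proof.
move=> c0; have KE := constant_curvatureE r0C.
have V0 := V_gt0 i r0_gt0.
have sE : s_alpha T alpha (c *: r0) = (c `^ alpha)^-1 * s.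
  rewrite /s_alpha.
  have -> : \sum_j K T (c *: r0) j * (c *: r0) 0 j = c * (\sum_j K T r0 j * r0 0 j).
    by rewrite mulr_sumr; apply: eq_bigr => j _; rewrite K_scale// mxE; ring.
  have -> : \sum_j (c *: r0) 0 j `^ (alpha + 1) = c `^ alpha * c * V r0.
    rewrite mulr_sumr; apply: eq_bigr => j _.
    by rewrite mxE powRM ?ltW// -powRS.
  rewrite /s /s_alpha -/(V r0).
  by field; rewrite !gt_eqF// powR_gt0.
rewrite /flow_field sE K_scale// KE mxE -/s.
have cr0 : 0 < c * r0 0 i by rewrite mulr_gt0.
rewrite powRDp// powRN powRM ?ltW// (powRM _ (ltW c0) (ltW (r0_gt0 i))).
by field; rewrite !gt_eqF// powR_gt0.
Qed.

Variable dK : 'I_N -> 'rV[R]_N.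
Hypothesis dKP : forall i, sdiff (fun r => K T r i) r0 (dK i).
Let L z z' := \sum_i z 0 i * dotv (dK i) z'.
Hypothesis Lsym : forall z z', L z z' = L z' z.
Hypothesis Lker : forall z, L z r0 = 0.

(** In the numerator the sum of the r_i dK_i vanishes, by symmetry of [L] and because [r0] is in its
    kernel. What remains of the numerator contributes s and the denominator - (alpha + 1) s, which
    leaves - alpha s. *)
Lemma sdiff_s_alpha : exists2 ds, sdiff (s_alpha T alpha) r0 ds &
  forall z, dotv ds z = - (alpha * s) * (\sum_i r0 0 i `^ alpha * z 0 i) / V r0.
Proof.
have dS : sdiff (fun r => \sum_i K T r i * r 0 i) r0
    (\sum_i (r0 0 i *: dK i + K T r0 i *: delta_mx 0 i)).
  by apply: sdiff_sum => i _; apply: sdiffM; [exact: dKP|exact: sdiff_coord].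
have dV : sdiff V r0 (\sum_i ((alpha + 1) * r0 0 i `^ (alpha + 1 - 1)) *: delta_mx 0 i).
  apply: sdiff_sum => i _.
  by apply: (sdiff_comp (sdiff1_powR (alpha + 1) (r0_gt0 i))); exact: sdiff_coord.
have V0 := V_gt0 i0 r0_gt0.
have ds := sdiffM dS (sdiffV (lt0r_neq0 V0) dV).
eexists; first exact: ds.
move=> z; rewrite !(dotvDl, dotvZl) !dotv_suml.
have -> : \sum_i dotv (r0 0 i *: dK i + K T r0 i *: delta_mx 0 i) z =
    s * \sum_i r0 0 i `^ alpha * z 0 i.
  under eq_bigr do rewrite dotvDl !dotvZl dotv_delta (constant_curvatureE r0C).
  rewrite big_split/= -[X in X + _]/(L r0 z) Lsym Lker add0r mulr_sumr.
  by apply: eq_bigr => i _; rewrite /s; ring.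
have -> : \sum_i dotv (((alpha + 1) * r0 0 i `^ (alpha + 1 - 1)) *: delta_mx 0 i) z =
    (alpha + 1) * \sum_i r0 0 i `^ alpha * z 0 i.
  by rewrite mulr_sumr; apply: eq_bigr => i _; rewrite addrK dotvZl dotv_delta; ring.
have -> : \sum_i K T r0 i * r0 0 i = s * V r0.
  by rewrite /s /s_alpha -/(V r0) divfK// gt_eqF.
by field; rewrite gt_eqF.
Qed.

(** The field is r_i^beta (s_alpha - K_i r_i^(- alpha)), whose second factor is 0 at [r0]. Thus
    r_i^beta is not differentiated, and after weighting [beta] disappears from the right side. *)
Lemma sdiff_flow_field i : exists2 dF, sdiff (fun r =>
  flow_field T alpha beta r i) r0 dF &
  forall z, r0 0 i `^ (alpha - beta) * dotv dF z =
    alpha * s * (r0 0 i `^ (alpha - 1) * z 0 i) - dotv (dK i) z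
    - alpha * s * (\sum_j r0 0 j `^ alpha * z 0 j) / V r0 * r0 0 i `^ alpha.
Proof.
have [ds sds dsE] := sdiff_s_alpha.
have dp p : sdiff (fun r : 'rV[R]_N => r 0 i `^ p) r0 ((p * r0 0 i `^ (p - 1)) *:
  delta_mx 0 i).
  by apply: (sdiff_comp (sdiff1_powR p (r0_gt0 i))); exact: sdiff_coord.
have d1 := sdiffM sds (dp beta).
have d2 := sdiffM (dKP i) (dp (beta - alpha)).
eexists; first exact: (sdiffB d1 d2).
move=> z; rewrite !(dotvDl, dotvNl, dotvZl) dsE dotv_delta (constant_curvatureE r0C) -/s.
have V0 := V_gt0 i0 r0_gt0.
have r00 := r0_gt0 i.
rewrite !powRDp// !powRN powRr1 ?ltW//.
have [pa pb] : 0 < r0 0 i `^ alpha /\ 0 < r0 0 i `^ beta by rewrite !powR_gt0.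
move: (r0 0 i `^ alpha) (r0 0 i `^ beta) pa pb => A B A0 B0.
by field; rewrite !gt_eqF.
Qed.

(* The weights r_i^(alpha - beta) turn the linearization into a symmetric form. *)
Lemma flow_field_linearization :
  exists2 dF : 'I_N -> 'rV[R]_N,
    forall i, sdiff (fun r => flow_field T alpha beta r i) r0 (dF i) &
    forall z, \sum_i r0 0 i `^ (alpha - beta) * z 0 i * dotv (dF i) z =
      - linearized_form dK (fun i => r0 0 i `^ (alpha - 1)) r0 (alpha * s) z.
Proof.
have /choice[dF dFP] : forall i, exists dF, sdiff (fun r =>
  flow_field T alpha beta r i) r0 dF /\
  forall z, r0 0 i `^ (alpha - beta) * dotv dF z =
    alpha * s * (r0 0 i `^ (alpha - 1) * z 0 i) - dotv (dK i) z
    - alpha * s * (\sum_j r0 0 j `^ alpha * z 0 j) / V r0 * r0 0 i `^ alpha.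
  by move=> i; have [dF h1 h2] := sdiff_flow_field i; exists dF.
exists dF => [i|z]; first by case: (dFP i).
rewrite /linearized_form.
have powa i : r0 0 i `^ alpha = r0 0 i `^ (alpha - 1) * r0 0 i by rewrite -powRS// subrK.
have -> : \sum_i r0 0 i `^ (alpha - 1) * r0 0 i * r0 0 i = V r0.
  by apply: eq_bigr => i _; rewrite -powa -powRS.
pose m := \sum_i r0 0 i `^ alpha * z 0 i.
have -> : \sum_i r0 0 i `^ (alpha - 1) * z 0 i * r0 0 i = m.
  by apply: eq_bigr => i _; rewrite powa; ring.
transitivity (\sum_i (alpha * s * (r0 0 i `^ (alpha - 1) * z 0 i * z 0 i)
   - z 0 i * dotv (dK i) z - alpha * s * m / V r0 * (r0 0 i `^ alpha * z 0 i))).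
  apply: eq_bigr => i _; have [_ h] := dFP i.
  by rewrite -mulrA mulrCA h -/m; ring.
rewrite !sumrB -!mulr_sumr -/m.
by ring.
Qed.

End Equilibrium.
End FlowField.

(** * Stability of the flow *)

Lemma nbhs_forall (R : realType) (n : nat) (I : finType) (x : 'rV[R]_n)
    (P : I -> set 'rV[R]_n) :
  (forall i, nbhs x (P i)) -> nbhs x [set y | forall i, P i y].
Proof.
move=> xP.
suff /(_ (enum I)) : forall s : seq I, nbhs x [set y | forall i, i \in s -> P i y].
  by apply: filterS => y h i; apply: h; rewrite mem_enum.
elim=> [|i s ih]; first by apply/nbhs_rVP; exists 1 => // y _ i.
apply: filterS (filterI (xP i) ih) => y [Py h] j; rewrite inE => /orP[/eqP->//|].
exact: h.
Qed.

Lemma ball_packing_metrics_nbhs (R : realType) (N : nat) (T : {set {set 'I_N}})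
    (r : 'rV[R]_N) :
  ball_packing_metrics T r -> nbhs r (ball_packing_metrics T).
Proof.
move=> [r0 Qr].
have hQ : nbhs r [set y | forall s : {set 'I_N}, s \in tetrahedra T -> 0 < Q y s].
  apply: nbhs_forall => s; have [sT|sT] := boolP (s \in tetrahedra T); last first.
    by apply/nbhs_rVP; exists 1.
  have [g dQ] : exists g, sdiff (fun y : 'rV[R]_N => Q y s) r g.
    eexists; apply: sdiffB.
      apply: (sdiff_comp (sdiff1_sqr _)).
      by apply: sdiff_sum => i _; apply: sdiffV; [rewrite gt_eqF|exact: sdiff_coord].
    apply: sdiffZ; apply: sdiff_sum => i _; apply: sdiffV.
      by rewrite gt_eqF// exprn_gt0.
    by apply: (sdiff_comp (sdiff1_sqr _)); exact: sdiff_coord.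
  have h : nbhs (Q r s) [set u | 0 < u] by apply: lt_nbhsr; exact: Qr.
  have h' : nbhs r [set y | 0 < Q y s] := sdiff_continuous dQ h.
  by apply: filterS h' => y Qy _.
by apply: filterS (filterI (nbhs_pos r0) hQ) => y [].
Qed.

(** * The conserved quantity *)

Section Invariant.
Variables (R : realType) (N : nat) (T : {set {set 'I_N}}) (alpha beta : R).
Implicit Types (r z : 'rV[R]_N).
Let inv r := @flow_invariant R N alpha beta r.
Let p := alpha - beta + 2.

Lemma sdiff_invariant : exists2 k : R, k != 0 &
  forall r, (forall i, 0 < r 0 i) ->
  sdiff inv r (k *: \row_i r 0 i `^ (alpha - beta + 1)) /\
  forall (Z : R -> 'rV[R]_N) (dZ : 'rV[R]_N) (t : R), Z t = r ->
    (forall i, is_derive t 1 (fun u => Z u 0 i) (dZ 0 i)) ->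
    is_derive t 1 (inv \o Z) (k * \sum_i r 0 i `^ (alpha - beta + 1) * dZ 0 i).
Proof.
have rowE (k : R) (c : 'I_N -> R) : k *: \row_i c i = \sum_i (k * c i) *: delta_mx 0 i.
  rewrite [\row_i c i]row_sum_delta scaler_sumr.
  by apply: eq_bigr => i _; rewrite mxE scalerA.
have pE : p - 1 = alpha - beta + 1 by rewrite /p; ring.
have [p0|pN0] := eqVneq p 0.
  exists 1; first exact: oner_neq0.
  move=> r r0; have invE : inv = (fun r => \sum_i ln (r 0 i)).
    by apply/funext => y; rewrite /inv /flow_invariant -/p p0 eqxx.
  have rE i : r 0 i `^ (alpha - beta + 1) = (r 0 i)^-1.
    by rewrite -pE p0 sub0r powRN powRr1// ltW.
  split.
    rewrite invE rowE; apply: sdiff_sum => i _; rewrite mul1r rE.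
    by apply: sdiff_comp; [exact: sdiff1_ln|exact: sdiff_coord].
  move=> Z dZ t Zt dZP; rewrite invE mul1r; apply: is_derive_bigsum => i.
  rewrite rE; apply: (is_derive1_comp (f := @ln R)) => //.
  by rewrite Zt; exact: is_derive1_ln.
exists p => // r r0; have invE : inv = (fun r => \sum_i r 0 i `^ p).
  by apply/funext => y; rewrite /inv /flow_invariant -/p (negbTE pN0).
split.
  rewrite invE rowE; apply: sdiff_sum => i _; rewrite -pE.
  by apply: (sdiff_comp (sdiff1_powR p (r0 i))); exact: sdiff_coord.
move=> Z dZ t Zt dZP; rewrite invE mulr_sumr; apply: is_derive_bigsum => i.
rewrite mulrA -pE; apply: (is_derive1_comp (f := fun x => x `^ p)) => //.
by rewrite Zt; exact: is_derive1_powR.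
Qed.

(** Along the ray of [r] the invariant is N ln c + [inv r] or c^p [inv r], hence injective. [g] is
    its continuous local inverse, and picks the equilibrium on a given level set. *)
Lemma invariant_scale r (i0 : 'I_N) : (forall i, 0 < r 0 i) ->
  (exists g : R -> R, [/\ {for inv r, continuous g}, g (inv r) = 1 &
     \forall y \near inv r, 0 < g y /\ inv (g y *: r) = y]) /\
  forall c, 0 < c -> inv (c *: r) = inv r -> c = 1.
Proof.
move=> r0.
have powC (q x : R) : 0 < x -> {for x, continuous (fun y => y `^ q)}.
  by move=> x0; have [/derivable1_diffP/differentiable_continuous] :=
    is_derive1_powR q x0.
have [p0|pN0] := eqVneq p 0.
  have n0 : N%:R != 0 :> R by rewrite pnatr_eq0 -lt0n (leq_ltn_trans (leq0n i0)).
  have invE c : 0 < c -> inv (c *: r) = N%:R * ln c + inv r.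
    move=> c0; rewrite /inv /flow_invariant -/p p0 eqxx.
    under eq_bigr do rewrite mxE lnM ?posrE//.
    by rewrite big_split/= sumr_const card_ord mulr_natl.
  split; last first.
    move=> c c0; rewrite invE// => /(canRL (addrK _)); rewrite subrr => /eqP.
    by rewrite mulf_eq0 (negbTE n0)/= ln_eq0// => /eqP.
  exists (fun y => expR ((y - inv r) / N%:R)); split.
  - apply: (@continuous_comp _ _ _ (fun y => (y - inv r) / N%:R) expR);
    last exact: continuous_expR.
    apply: cvgM; last exact: cvg_cst.
    by apply: cvgB; [exact: cvg_id|exact: cvg_cst].
  - by rewrite subrr mul0r expR0.
  - near=> y; split; first exact: expR_gt0.
    by rewrite invE ?expR_gt0// expRK mulrC divfK// subrK.
have invE c : 0 < c -> inv (c *: r) = c `^ p * inv r.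
  move=> c0; rewrite /inv /flow_invariant -/p (negbTE pN0) mulr_sumr.
  by apply: eq_bigr => i _; rewrite mxE powRM// ltW.
have inv0 : 0 < inv r.
  rewrite /inv /flow_invariant -/p (negbTE pN0) (bigD1 i0)//= ltr_pwDl ?powR_gt0//.
  by rewrite sumr_ge0// => i _; exact: powR_ge0.
split; last first.
  move=> c c0; rewrite invE// => h.
  have cp : c `^ p = 1 by apply: (mulIf (lt0r_neq0 inv0)); rewrite mul1r.
  by rewrite -[LHS]powRr1 ?ltW// -[X in c `^ X](mulfV pN0) powRrM cp powR1.
exists (fun y => (y / inv r) `^ p^-1); split.
- apply: (@continuous_comp _ _ _ (fun y : R => y / inv r) (fun y : R => y `^ p^-1)).
    by apply: cvgM; [exact: cvg_id|exact: cvg_cst].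
  by apply: powC; rewrite divr_gt0.
- by rewrite divff ?gt_eqF// powR1.
- have : \forall y \near inv r, 0 < y by exact: lt_nbhsr.
  apply: filterS => y y0; have yi : 0 < y / inv r by rewrite divr_gt0.
  split; first exact: powR_gt0.
  by rewrite invE ?powR_gt0// -powRrM mulVf// powRr1 ?ltW// divfK// gt_eqF.
Unshelve. all: by end_near. Qed.

Lemma invariant_flow (i0 : 'I_N) (Z : R -> 'rV[R]_N) (t : R) :
  (forall i, 0 < Z t 0 i) ->
  (forall i, is_derive t 1 (fun u => Z u 0 i) (flow_field T alpha beta (Z t) i)) ->
  is_derive t 1 (inv \o Z) 0.
Proof.
move=> Z0 Zd; have [k k0 kP] := sdiff_invariant.
have [_ /(_ Z (\row_i flow_field T alpha beta (Z t) i) t erefl)] := kP _ Z0.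
move=> h; apply: (is_derive_eq (h _)); first by move=> i; rewrite mxE.
have V0 := V_gt0 alpha i0 Z0.
apply/eqP; rewrite mulf_eq0 (negbTE k0)/=; apply/eqP.
transitivity (s_alpha T alpha (Z t) * (\sum_i Z t 0 i `^ (alpha +
  1)) - \sum_i K T (Z t) i * Z t 0 i).
  rewrite mulr_sumr -sumrB; apply: eq_bigr => i _; rewrite mxE /flow_field.
  have Zi := Z0 i; rewrite !powRDp// !powRN powRr1 ?ltW//.
  by field; rewrite !gt_eqF// powR_gt0.
by rewrite /s_alpha divfK ?subrr// gt_eqF.
Qed.

End Invariant.

Section Stability.
Variables (R : realType) (M : topologicalType) (N : nat) (T : {set {set 'I_N}}).
Variables (alpha beta : R) (rstar : 'rV[R]_N) (i0 : 'I_N).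
Hypothesis HT : triangulated_3manifold R M T.
Hypothesis Hstar : constant_curvature_metric T alpha rstar.
Hypothesis Hspec :
  (exists2 lambda1 : R,
     is_first_positive_eigenvalue (- Laplacian T alpha rstar) lambda1 &
     alpha * s_alpha T alpha rstar < lambda1)
  \/ alpha * s_alpha T alpha rstar <= 0.

Let rstar_gt0 i : 0 < rstar 0 i. Proof. by case: Hstar => -[]. Qed.
Let m i := rstar 0 i `^ (alpha - beta).
Let inv := @flow_invariant R N alpha beta.
Let F (r : 'rV[R]_N) : 'rV[R]_N := \row_i flow_field T alpha beta r i.

Lemma coercive_linearization :
  exists dF : 'I_N -> 'rV[R]_N, exists2 dI : 'rV[R]_N,
    (forall i, sdiff (fun r => flow_field T alpha beta r i) rstar (dF i)) /\
    sdiff inv rstar dI &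
    exists2 k, 0 < k & forall z : 'rV[R]_N,
      k * `|z| ^+ 2 <= - (\sum_i m i * z 0 i * dotv (dF i) z) + dotv dI z ^+ 2.
Proof.
have [rM _] := Hstar.
have [dK [dKP Lsym Lker Lge0 Ltet]] := curvature_gradient rM.
have Ldef (z : 'rV[R]_N) : \sum_i z 0 i * dotv (dK i) z = 0 -> exists t, z = t *: rstar.
  move=> /Ltet h; exists (z 0 i0 / rstar 0 i0); apply/rowP => i; rewrite mxE.
  rewrite (triangulation_connected (f := fun i => z 0 i / rstar 0 i) HT h i0 i).
  by rewrite divfK// gt_eqF.
have [dF dFP dFE] := flow_field_linearization beta i0 Hstar dKP Lsym Lker.
have [k1 k10 k1P] := @sdiff_invariant R N alpha beta.
have [dI _] := k1P _ rstar_gt0.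
exists dF; eexists; first by split; [exact: dFP|exact: dI].
have c_gt0 i : 0 < rstar 0 i `^ (alpha - 1) by rewrite powR_gt0.
have rN0 : rstar != 0.
  by apply/eqP => r0; have := rstar_gt0 i0; rewrite r0 mxE ltxx.
have Irstar : dotv (k1 *: \row_i rstar 0 i `^ (alpha - beta + 1)) rstar != 0.
  rewrite dotvZl mulf_neq0// gt_eqF// /dotv (bigD1 i0)//= ltr_pwDl//.
    by rewrite mxE mulr_gt0 ?powR_gt0.
  by rewrite sumr_ge0// => i _; rewrite mxE mulr_ge0 ?powR_ge0// ltW.
have Bgt0 := @linearized_form_gt0 _ _ dK _ rstar c_gt0 rN0 Lsym Lker Lge0 Ldef
  (alpha * s_alpha T alpha rstar).
have [|k k0 kP] := @linearized_form_coercive _ _ dK _ rstar c_gt0 rN0 Lker _ _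
  Irstar (Bgt0 _).
  case: Hspec => [[l1 [l10 _ l1min] sl1]|]; last by right.
  left; exists l1 => // mu v mu0 vN0 vE; apply: l1min => //; apply/eigenvalueP.
  (* The factor r_i^alpha cancels the left factor of the Laplacian; [L v z = mu * D v z] at basis
     vectors then says that this row is a left eigenvector. *)
  exists (\row_i (v 0 i * rstar 0 i `^ alpha)); last first.
    apply: contra vN0 => /eqP v0; apply/eqP/rowP => i; rewrite mxE.
    have := congr1 (fun u : 'rV[R]_N => u 0 i) v0; rewrite !mxE => /eqP.
    by rewrite mulf_eq0 (gt_eqF (powR_gt0 _ (rstar_gt0 i))) orbF => /eqP.
  rewrite /Laplacian opprK; apply/rowP => j; rewrite !mxE.
  transitivity (rstar 0 j * \sum_i v 0 i * dotv (dK i) (delta_mx 0 j)).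
    rewrite mulr_sumr; apply: eq_bigr => i _; rewrite mul_mx_diag mul_diag_mx !mxE.
    rewrite (sdiff_derive (delta_mx 0 j) (dKP i)) powRN.
    by field; rewrite gt_eqF// powR_gt0.
  rewrite vE (bigD1 j)//= big1 => [|i /negPf ij]; rewrite mxE eqxx/=;
    last by rewrite ij mulr0.
  rewrite eqxx mulr1 addr0 -[in RHS](subrK 1 alpha) powRS//.
  by ring.
by exists k => // z; rewrite dFE opprK; exact: kP.
Qed.

(* The point c rstar of the level set of the invariant through x is close to
   rstar, and both expansions at rstar are uniform in the base point, so the
   quadratic estimate transfers from rstar to c rstar. *)
Lemma local_stability : exists2 delta : R, 0 < delta &
  forall r0 : 'rV[R]_N, ball_packing_metrics T r0 -> `|r0 - rstar| < delta ->
  exists r : R -> 'rV[R]_N, exists2 c : R,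
    [/\ 0 < c, inv (c *: rstar) = inv r0 & r t @[t --> +oo] --> c *: rstar] &
    flow_solution T alpha beta r0 +oo%E r /\
    (forall (b : \bar R) (r' : R -> 'rV[R]_N),
       flow_solution T alpha beta r0 b r' ->
       forall t : R, 0 <= t -> (t%:E < b)%E -> r' t = r t).
Proof.
have [dF [dI [dFP dIP] [k k0 kP]]] := coercive_linearization.
have m0 i : 0 < m i by rewrite powR_gt0.
pose S := \sum_i m i.
have S0 : 0 <= S by rewrite sumr_ge0// => i _; rewrite ltW.
(* The linearization error of the field costs eps S |z|^2 and the squared differential of the
   invariant eps |z|^2, the latter thanks to eps <= 1. Together they use up at most half of [k]. *)
pose eps := Num.min 1 (k / 2 / (1 + S)).
have S1 : 0 < 1 + S by rewrite ltr_pwDl.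
have eps0 : 0 < eps by rewrite lt_min ltr01 !divr_gt0.
have eps1 : eps <= 1 by rewrite ge_min lexx.
have epsS : eps * (1 + S) <= k / 2 by rewrite -ler_pdivlMr// ge_min lexx orbT.
have /choice[U UP] : forall i, exists U, nbhs rstar U /\ forall y z, U y -> U z ->
    `|flow_field T alpha beta y i - flow_field T alpha beta z i - dotv (dF i) (y -
      z)| <= eps * `|y - z|.
  by move=> i; have [U Un Uh] := dFP i eps eps0; exists U.
have [W Wn WP] := dIP eps eps0.
have Un : nbhs rstar [set y | forall i, U i y].
  by apply: nbhs_forall => i; have [] := UP i.
have Mn := ball_packing_metrics_nbhs Hstar.1.
have hB : nbhs rstar (ball_packing_metrics T `&` ([set y | forall i, U i y] `&` W)).
  by apply: filterI => //; exact: filterI.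
have [d d0 hd] := (nbhs_rVP _ _).1 hB.
pose rho := d / 2.
have rho0 : 0 < rho by rewrite divr_gt0.
have inB x : `|x - rstar| <= rho -> [/\ ball_packing_metrics T x, forall i, U i x & W x].
  move=> h; have [|? [? ?] //] := hd x.
  by apply: (le_lt_trans h); rewrite /rho; lra.
have inpos x : `|x - rstar| <= rho -> forall i, 0 < x 0 i.
  by move=> /inB[[]].
pose L : R := \sum_i \sum_j `|dF i 0 j| + 1.
have L0 : 0 < L by rewrite ltr_wpDl// sumr_ge0// => i _; rewrite sumr_ge0.
have Flip x y : `|x - rstar| <= rho -> `|y - rstar| <= rho -> `|F x - F y| <=
  L * `|x - y|.
  move=> /inB[_ Ux _] /inB[_ Uy _]; apply: norm_le_coord; first by rewrite mulr_ge0// ltW.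
  move=> i; rewrite !mxE.
  rewrite -[flow_field _ _ _ x i - _](subrK (dotv (dF i) (x - y))).
  apply: (le_trans (ler_normD _ _)); rewrite /L mulrDl [leRHS]addrC lerD//; last first.
    apply: (le_trans (dotv_le_norm _ _)); rewrite ler_wpM2r// [leRHS](bigD1 i)//= lerDl.
    by rewrite sumr_ge0// => j _; rewrite sumr_ge0.
  have [_ h] := UP i; apply: (le_trans (h _ _ (Ux i) (Uy i))).
  by rewrite ler_wpM2r.
(* The other half of [k], divided by a bound for the energy in terms of |z|^2. *)
pose kappa := k / 2 / (1 + S).
have kappa0 : 0 < kappa by rewrite !divr_gt0.
have [k1 k10 k1P] := @sdiff_invariant R N alpha beta.
have Icont x : `|x - rstar| <= rho -> {for x, continuous inv}.
  by move=> /inpos/k1P[h _]; exact: sdiff_continuous h.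
have Iflow Z (t : R) : `|Z t - rstar| <= rho ->
    (forall i, is_derive t 1 (fun u => Z u 0 i) (F (Z t) 0 i)) -> is_derive t 1 (inv
      \o Z) 0.
  move=> /inpos Z0 Zd; apply: (invariant_flow (T := T) i0 Z0) => i.
  by have := Zd i; rewrite mxE.
have Fdissip c : 0 < c -> `|c *: rstar - rstar| <= rho -> forall x, `|x - rstar| <= rho ->
    inv x = inv (c *: rstar) ->
    \sum_i m i * (x 0 i - (c *: rstar) 0 i) * F x 0 i <=
      - kappa * energy m (c *: rstar) x.
  move=> c0 /inB[_ Ue We] x /inB[_ Ux Wx] xe.
  set e := c *: rstar in Ue We xe *; pose z := x - e.
  have zE i : x 0 i - e 0 i = z 0 i by rewrite !mxE.
  (* [x] and [e] lie on one level set, so the two-point expansion of the invariant reduces to its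
     linear term. *)
  have hI : dotv dI z ^+ 2 <= eps * `|z| ^+ 2.
    have := WP _ _ Wx We; rewrite xe subrr sub0r normrN => h.
    rewrite -(real_normK (num_real (dotv dI z))).
    apply: (@le_trans _ _ ((eps * `|z|) ^+ 2)).
      by rewrite ler_sqr ?nnegrE// mulr_ge0// ltW.
    by rewrite exprMn ler_wpM2r ?sqr_ge0// expr2 ler_piMr// ltW.
  have hF : \sum_i m i * (x 0 i - e 0 i) * F x 0 i <=
      \sum_i m i * z 0 i * dotv (dF i) z + eps * S * `|z| ^+ 2.
    rewrite [eps * S]mulrC -mulrA /S mulr_suml -big_split/=; apply: ler_sum => i _.
    have -> : F x 0 i = flow_field T alpha beta x i by rewrite mxE.
    rewrite zE -!mulrA -mulrDr ler_pM2l//.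
    rewrite -lerBlDl -mulrBr; apply: (le_trans (ler_norm _)); rewrite normrM expr2 mulrCA.
    rewrite ler_pM//; first exact: coord_le_norm.
    have [_ h] := UP i; have := h _ _ (Ux i) (Ue i).
    by rewrite (flow_field_equilibrium beta Hstar i c0) subr0.
  have hE : energy m e x <= S * `|z| ^+ 2 by apply: energy_le => i; rewrite ltW.
  have hk := kP z.
  apply: (le_trans hF).
  have hz : 0 <= `|z| ^+ 2 by rewrite exprn_ge0.
  have h1 : eps * S * `|z| ^+ 2 + eps * `|z| ^+ 2 <= k / 2 * `|z| ^+ 2.
    rewrite -mulrDl ler_wpM2r//; apply: le_trans epsS.
    by rewrite mulrDr mulr1 addrC.
  have h2 : kappa * energy m e x <= k / 2 * `|z| ^+ 2.
    apply: (@le_trans _ _ (kappa * ((1 + S) * `|z| ^+ 2))).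
      by rewrite ler_pM2l// (le_trans hE)// ler_wpM2r// lerDr.
    by rewrite mulrA /kappa divfK// gt_eqF.
  rewrite mulNr; lra.
have [a a0 am] : exists2 a, 0 < a & forall i, a <= m i.
  have D0 : 0 < 1 + \sum_i (m i)^-1.
    by rewrite ltr_pwDl// sumr_ge0// => i _; rewrite invr_ge0 ltW.
  exists (1 + \sum_i (m i)^-1)^-1; first by rewrite invr_gt0.
  move=> i; rewrite -[m i]invrK lef_pV2 ?posrE ?invr_gt0//.
  rewrite (bigD1 i)//= addrCA lerDl addr_ge0// sumr_ge0// => j _.
  by rewrite invr_ge0 ltW.
(* Ensures S tau^2 <= a, so that a start within [eta] of [e] has the small energy required by
   [stable_flow]. *)
pose tau := Num.min 1 (a / (1 + S)).
have tau0 : 0 < tau by rewrite lt_min ltr01 divr_gt0.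
have tau1 : tau <= 1 by rewrite ge_min lexx.
have tauS : tau * (1 + S) <= a by rewrite -ler_pdivlMr// ge_min lexx orbT.
pose eta := rho / 4 * tau.
have eta0 : 0 < eta by rewrite mulr_gt0// divr_gt0.
have eta_rho : eta <= rho / 4 by rewrite ler_piMr// ltW// divr_gt0.
have etaS : S * eta ^+ 2 <= a * (rho / 4) ^+ 2.
  rewrite /eta exprMn mulrCA mulrC ler_wpM2r ?sqr_ge0//.
  apply: le_trans tauS; rewrite mulrC.
  apply: (@le_trans _ _ (tau * S)); last by rewrite ler_pM2l// lerDr.
  by rewrite ler_wpM2r// expr2 ler_piMr// ltW.
have [[g [gC g1 gP]] _] := invariant_scale alpha beta i0 rstar_gt0.
have rs1 : 0 < `|rstar| + 1 by rewrite ltr_wpDl.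
have gn : nbhs rstar [set x | (0 < g (inv x) /\ inv (g (inv x) *: rstar) = inv x) /\
    `|1 - g (inv x)| < eta / 2 / (`|rstar| + 1)].
  have rr : `|rstar - rstar| <= rho by rewrite subrr normr0 ltW.
  have h1 : nbhs rstar [set x | 0 < g (inv x) /\ inv (g (inv x) *: rstar) =
    inv x] := Icont _ rr _ gP.
  have gC' : nbhs (inv rstar) [set y | `|1 - g y| < eta / 2 / (`|rstar| + 1)].
    have e20 : 0 < eta / 2 / (`|rstar| + 1) by rewrite !divr_gt0.
    suff : \forall y \near inv rstar, `|g (inv rstar) - g y| < eta / 2 / (`|rstar| + 1).
      by rewrite g1.
    by apply: (cvgr_dist_lt (F := nbhs (inv rstar))).
  have h2 : nbhs rstar [set x | `|1 - g (inv x)| < eta / 2 / (`|rstar| +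
    1)] := Icont _ rr _ gC'.
  by apply: filterS (filterI h1 h2) => x [].
have [d1 d10 hd1] := (nbhs_rVP _ _).1 gn.
(* Within [d1] the equilibrium [e] on the level of [r0] is eta/2-close to [rstar]; with |r0 - rstar|
   < eta/2 this gives |r0 - e| <= eta. *)
exists (Num.min d1 (eta / 2)); first by rewrite lt_min d10 divr_gt0.
move=> r0 r0M; rewrite lt_min => /andP[/hd1[[c0 cinv] c1] r0eta].
move: c0 cinv c1; set c := g (inv r0) => c0 cinv c1.
pose e := c *: rstar.
have ers : `|e - rstar| <= eta / 2.
  rewrite /e -[X in _ - X]scale1r -scalerBl normrZ distrC.
  apply: (@le_trans _ _ (`|1 - c| * (`|rstar| + 1))); first by rewrite ler_wpM2l// lerDl.
  by rewrite -ler_pdivlMr// ltW.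
have ep : `|e - rstar| <= rho / 4 by move: ers eta_rho eta0; lra.
have erho : `|e - rstar| <= rho by move: ep rho0; lra.
have r0e : `|r0 - e| <= eta.
  have -> : r0 - e = (r0 - rstar) + - (e - rstar) by rewrite opprB addrA subrK.
  by apply: (le_trans (ler_normD _ _)); rewrite normrN; move: ers r0eta; lra.
have r0small : energy m e r0 <= a * (rho / 4) ^+ 2.
  apply: le_trans etaS; apply: (le_trans (energy_le _ _ _)); first by move=> i;
    rewrite ltW.
  by rewrite ler_wpM2l// ler_sqr ?nnegrE// ltW.
have [Z [ZM Zl [Z0 Zp Zd Ze]]] := stable_flow rho0 L0 Flip a0 am kappa0 Icont Iflow
  (Fdissip c c0 erho) (esym cinv) ep r0small.
exists Z; exists c => //; split.
  split=> //.
  - move=> t t0 _; have [] // := inB (Z t); apply: (le_trans (Zp t t0)); move: rho0; lra.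
  - by apply: continuous_subspaceT; exact: lip_continuous_rV Zl.
  - by move=> t t0 _ i; have := Zd t t0 i; rewrite mxE.
move=> b r' [r'0 _ r'C r'd]; apply: (flow_unique rho0 L0 Flip Zl Zp Zd) => //.
  by rewrite r'0.
by move=> t t0 tb i; rewrite mxE; exact: r'd.
Qed.

End Stability.

Theorem theorem4p5 (R : realType) (M : topologicalType) (N : nat)
    (T : {set {set 'I_N}}) (HT : triangulated_3manifold R M T)
    (alpha beta : R) (rstar : 'rV[R]_N)
    (Hstar : constant_curvature_metric T alpha rstar)
    (Hspec :
      (exists2 lambda1 : R,
         is_first_positive_eigenvalue (- Laplacian T alpha rstar) lambda1 &
         alpha * s_alpha T alpha rstar < lambda1)
      \/ alpha * s_alpha T alpha rstar <= 0) :
  exists2 delta : R, 0 < delta &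
    forall r0 : 'rV[R]_N, ball_packing_metrics T r0 -> `|r0 - rstar| < delta ->
    exists r : R -> 'rV[R]_N,
      [/\ flow_solution T alpha beta r0 +oo%E r,
          (forall (b : \bar R) (r' : R -> 'rV[R]_N),
             flow_solution T alpha beta r0 b r' ->
             forall t : R, 0 <= t -> (t%:E < b)%E -> r' t = r t),
          (flow_invariant alpha beta r0 = flow_invariant alpha beta rstar ->
             r t @[t --> +oo] --> rstar) &
          (exists c : R,
             [/\ 0 < c,
                 flow_invariant alpha beta (c *: rstar)
                   = flow_invariant alpha beta r0 &
                 r t @[t --> +oo] --> c *: rstar])].
Proof.
(* For N = 0 all row vectors coincide and constant curves do; otherwise [i0] makes the sums over
   vertices positive. *)
have [[i0 _]|noi] := pselect (exists i : 'I_N, True); last first.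
  have eqr (x y : 'rV[R]_N) : x = y by apply/rowP => i; case: noi; exists i.
  exists 1 => // r0 r0M _; exists (fun=> r0); split.
  - split=> // [|t _ _ i]; last by case: noi; exists i.
    by apply: continuous_subspaceT => t; exact: cvg_cst.
  - by move=> b r' _ t _ _; exact: eqr.
  - by move=> _; rewrite (eqr rstar r0); exact: cvg_cst.
  - exists 1; split => //; first by rewrite (eqr (1 *: rstar) r0).
    by rewrite (eqr (1 *: rstar) r0); exact: cvg_cst.
have [delta delta0 h] := local_stability beta i0 HT Hstar Hspec.
exists delta => // r0 r0M r0d; have [r [c [c0 cinv rc] [rsol runiq]]] := h r0 r0M r0d.
exists r; split=> //; last by exists c.
have rstar_gt0 i : 0 < rstar 0 i by case: Hstar => -[].
have [_ inj] := invariant_scale alpha beta i0 rstar_gt0.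
by move=> r0inv; move: rc; rewrite (inj c c0) ?scale1r// cinv.
Qed.
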